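(* Let $k\ge2$ be a fixed integer, and let $\tau_k$ be the unique positive solution of $1-\tau_k/k-e^{-\tau_k}=0$. Let $\mathcal{G}_n$ be the giant of $\mathcal{D}_{n,k}$, let $\mathcal{G}_n^c=[n]\setminus\mathcal{G}_n$, and let $\mathcal{D}_{n,k}[\mathcal{G}_n^c]$ be the sub-digraph of $\mathcal{D}_{n,k}$ induced by $\mathcal{G}_n^c$. As $n\to\infty$: (a) Let $L_n$ be the length of the longest cycle in $\mathcal{D}_{n,k}[\mathcal{G}_n^c]$. Then $L_n=O_p(1)$. (b) Let $C_n$ be the number of cycles in $\mathcal{D}_{n,k}[\mathcal{G}_n^c]$. Then $C_n$ converges in distribution to $\mathrm{Poi}\left(\log\frac{1}{1-ke^{-\tau_k}}\right)$. (c) Let $C_{n,\ell}$ be the number of cycles of length $\ell$ in $\mathcal{D}_{n,k}[\mathcal{G}_n^c]$. Then for every fixed $\ell\ge1$, $C_{n,\ell}$ converges in distribution to $\mathrm{Poi}\left(\frac{(ke^{-\tau_k})^{\ell}}{\ell}\right)$.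
   Context: $[n]=\{1,\dots,n\}$. A $k$-out digraph is a digraph with vertex set $[n]$ in which each vertex has exactly $k$ out-arcs labeled $1,\dots,k$; self-loops and multiple arcs are allowed. $\mathcal{D}_{n,k}$ is a uniformly random $k$-out digraph on $[n]$; equivalently the endpoints of its $kn$ arcs are chosen independently and uniformly at random from $[n]$. A set $\mathcal{S}\subseteq[n]$ is closed if no arc starts in $\mathcal{S}$ and ends in $[n]\setminus\mathcal{S}$. The giant $\mathcal{G}_n$ is the vertex set of the largest closed strongly connected component of $\mathcal{D}_{n,k}$ (if there is more than one of largest size, the one containing the smallest vertex label). Cycles are directed cycles with distinct vertices, and are counted with arc labels (two cycles using different labeled arcs are different); a self-loop is a cycle of length 1. The length of the longest cycle is $0$ if there is no cycle. $\mathrm{Poi}(x)$ is the Poisson distribution with mean $x$. $\log$ is the natural logarithm. $X_n=O_p(1)$ means that the sequence $(X_n)$ is bounded in probability (tight). *)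

(* Defs.v *)
From mathcomp Require Import all_boot all_order all_algebra.
From mathcomp Require Import all_classical all_reals all_analysis.
From mathcomp Require Import lra.

Set Implicit Arguments.
Unset Strict Implicit.
Unset Printing Implicit Defensive.

Import Order.TTheory GRing.Theory Num.Theory.
Import numFieldNormedType.Exports.

Local Open Scope ring_scope.

Section Digraph.
Variables n k : nat.

(* The pair (v, i) is the out-arc of v labeled i, and D (v, i) its endpoint;
   vertices and labels are numbered from 0 instead of 1. *)
Definition kout : Type := {ffun 'I_n * 'I_k -> 'I_n}.

Implicit Types (D : kout) (S C : {set 'I_n}) (A : {set 'I_n * 'I_k}).

Definition adj D : rel 'I_n := fun u v => [exists i : 'I_k, D (u, i) == v].

Definition closed_set D S : bool :=
  [forall a : 'I_n * 'I_k, (a.1 \in S) ==> (D a \in S)].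

Definition scc D (v : 'I_n) : {set 'I_n} :=
  [set w | connect (adj D) v w && connect (adj D) w v].

Definition closed_sccs D : {set {set 'I_n}} :=
  [set C | [exists v, C == scc D v] && closed_set D C].

Definition largest_closed_sccs D : {set {set 'I_n}} :=
  [set C in closed_sccs D | [forall C' in closed_sccs D, (#|C'| <= #|C|)%N]].

(* The union has exactly one term when 0 < n: distinct components are
   disjoint, so only one contains the smallest label. *)
Definition giant D : {set 'I_n} :=
  \bigcup_(C in largest_closed_sccs D |
           [exists v in C, forall C' in largest_closed_sccs D,
              forall u in C', (v <= u)%N]) C.

(* A cycle is identified with its set of labeled arcs, which determines it up
   to the choice of a starting point since its vertices are distinct; its
   length is then the cardinality of that set. *)
Definition is_cycle D A : bool :=
  (A != finset.set0) &&
  [exists p : #|A|.-tuple ('I_n * 'I_k),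
     [&& cycle (fun a b => D a == b.1) p, uniq [seq a.1 | a <- p]
       & A == [set a in p]]].

Definition induced_arcs D S : {set 'I_n * 'I_k} :=
  [set a | (a.1 \in S) && (D a \in S)].

Definition induced_cycles D S : {set {set 'I_n * 'I_k}} :=
  [set A : {set 'I_n * 'I_k} | (A \subset induced_arcs D S) && is_cycle D A].

Definition longest_cycle D : nat :=
  \max_(A | A \in induced_cycles D (~: giant D)) #|A|.

Definition num_cycles D : nat := #|induced_cycles D (~: giant D)|.

Definition num_cycles_of_length (l : nat) D : nat :=
  #|[set A in induced_cycles D (~: giant D) | #|A| == l]|.

End Digraph.

Section Probability.
Variables (R : realType) (k : nat).

Definition Pr (n : nat) (E : pred (kout n k)) : R :=
  #|[set D : kout n k | E D]|%:R / #|{: kout n k}|%:R.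

Definition bounded_in_probability (X : forall n, kout n k -> nat) : Prop :=
  forall eps : R, 0 < eps ->
    exists M : R, forall n, Pr (fun D : kout n k => M < (X n D)%:R) <= eps.

Definition rv_cdf (n : nat) (X : kout n k -> nat) (x : R) : R :=
  Pr (fun D => (X D)%:R <= x).

(* The second explicit argument of poisson_prob is a dummy. *)
Definition poisson_cdf (rate x : R) : R :=
  fine (poisson_prob rate 0 [set m : nat | m%:R <= x]%classic).

Definition cvg_in_distribution (X : forall n, kout n k -> nat) (F : R -> R) :
    Prop :=
  forall x : R, {for x, continuous F} ->
    (rv_cdf (X n) x @[n --> \oo] --> F x)%classic.

End Probability.

Definition is_tau (R : realType) (k : nat) (tau : R) : Prop :=
  0 < tau /\ 1 - tau / k%:R - expR (- tau) = 0.

Lemma is_tau_exists_unique (R : realType) (k : nat) :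
  (2 <= k)%N -> exists! tau : R, is_tau k tau.
Proof.
move=> k2; have k2R : (2 : R) <= k%:R by rewrite (ler_nat R 2 k).
have k0 : (0 : R) < k%:R by lra.
have kE (x : R) : k%:R * (x / k%:R) = x by rewrite mulrC divfK// gt_eqF.
pose f (t : R) := 1 - t / k%:R - expR (- t).
have lnk0 : 0 < ln k%:R :> R by apply: ln_gt0; lra.
have lnk_lt : 1 + ln k%:R < k%:R :> R.
  by rewrite -[ltRHS]lnK ?posrE// expR_gt1Dx// gt_eqF.
have fln : 0 <= f (ln k%:R).
  rewrite /f expRN lnK ?posrE// subr_ge0 lerBrDr -[X in X + _]div1r -mulrDl.
  by rewrite ler_pdivrMr// mul1r ltW.
have fk : f k%:R <= 0.
  by rewrite /f divff ?gt_eqF// subrr sub0r oppr_le0 ltW// expR_gt0.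
have cf : continuous f.
  move=> t; rewrite /f; apply: cvgB; last first.
    by apply: continuous_comp; [exact: opp_continuous|exact: continuous_expR].
  apply: cvgB; first exact: cvg_cst.
  by apply: cvgMr_tmp; exact: cvg_id.
have [|||t] := @IVT R f (ln k%:R) k%:R 0.
- lra.
- exact: continuous_subspaceT.
- by rewrite ge_min le_max fln fk orbT.
rewrite in_itv/= => /andP[lt _] ft0.
exists t; split; first by split => //; lra.
suff lt_absurd (s u : R) : is_tau k s -> is_tau k u -> s < u -> False.
  have Ht : is_tau k t by split => //; lra.
  move=> u Hu; have [/lt_absurd|/lt_absurd|//] := ltgtP t u; by case.
move=> [s0 Es] [u0 Eu] su.
have es : expR (- s) = 1 - s / k%:R by lra.
have eu : expR (- u) = 1 - u / k%:R by lra.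
have e1 : expR (- s) * (1 + (s - u)) < expR (- u).
  rewrite [ltRHS](_ : _ = expR (- s) * expR (s - u)); last first.
    by rewrite -expRD; congr expR; lra.
  by rewrite ltr_pM2l ?expR_gt0// expR_gt1Dx//; apply/eqP; lra.
have e2 : expR (- s) * (1 + s) < 1.
  rewrite [ltRHS](_ : _ = expR (- s) * expR s); last first.
    by rewrite -expRD addNr expR0.
  by rewrite ltr_pM2l ?expR_gt0// expR_gt1Dx// gt_eqF.
have p0 := expR_gt0 (- s).
set p := expR (- s) in es e1 e2 p0.
have h1 : k%:R * p < 1.
  by rewrite -(ltr_pM2r s0) mul1r -mulrA -{2}(kE s) ltr_pM2l//; lra.
have h2 : 1 < k%:R * p.
  have us : 0 < u - s by lra.
  rewrite -(ltr_pM2r us) mul1r -mulrA -{1}(kE (u - s)) ltr_pM2l// mulrBl; lra.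
lra.
Qed.

(* Main.v *)
(* The event that a given set S of more than n/2 vertices is a closed strongly
   connected component only involves the arcs starting in S, and then S is the
   giant; given this, the arcs starting outside S are still independent and
   uniform.  So one needs the size of the giant, and the cycles of a uniform
   digraph inside a fixed set U of m vertices.

   Size.  Every vertex of a closed component is hit from inside, so the
   expected number of closed components of size s is at most
   C(n, s) Surj(ks, s) / n^(ks), where Surj(ks, s) <= (ks)! (e^tau - 1)^s / tau^(ks).
   By Stirling this is at most e k s exp(s rate(s/n)), where rate vanishes at
   nu = tau / k, increases before nu and decreases after it.  Hence all closed
   components have size nu n + o(n), and nu > 1/2.

   Cycles.  Let X count the cycles in U with length in a bounded set.  Cycles
   with no arc in common are independent, and few cycles share an arc with
   another one (the excess arc costs a factor 1/n), so
   (j + 1) P(X = j + 1) = E[X] P(X = j) + O(1/n), which forces a Poisson limit.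
   Moreover k (1 - nu) < 1 makes long cycles unlikely by a first moment bound,
   which gives tightness and the passage to all lengths. *)

Require Import Defs.
From mathcomp Require Import all_boot all_order all_algebra.
From mathcomp Require Import perm.
From mathcomp Require Import all_classical all_reals all_analysis.
From mathcomp Require Import ring lra zify.

Set Implicit Arguments.
Unset Strict Implicit.
Unset Printing Implicit Defensive.

Import Order.TTheory GRing.Theory Num.Theory.
Import numFieldNormedType.Exports.

Local Open Scope ring_scope.

(** * Expectation and independence *)

Section Expectation.
Variables (R : realType) (n k : nat).
Implicit Types (D : kout n k) (A : {set 'I_n * 'I_k}) (f g : kout n k -> R).

Definition Ex f : R := (\sum_D f D) / #|{: kout n k}|%:R.

Lemma kout_ext D D' : D =1 D' -> D = D'.
Proof. exact: (iffLR (ffunP D D')). Qed.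

Lemma card_kout_gt0 : (0 < #|{: kout n k}|)%N.
Proof.
rewrite card_ffun card_prod !card_ord expn_gt0.
by case: n => // m; rewrite mul0n orbT.
Qed.

Lemma PrE (E : pred (kout n k)) : Pr R E = Ex (fun D => (E D)%:R).
Proof.
rewrite /Pr /Ex -sum1dep_card natr_sum big_mkcond/=; congr (_ / _).
by apply: eq_bigr => D _; case: (E D).
Qed.

Lemma eq_Ex f g : f =1 g -> Ex f = Ex g.
Proof. by move=> fg; congr (_ / _); apply: eq_bigr => D _; exact: fg. Qed.

Lemma le_Ex f g : (forall D, f D <= g D) -> Ex f <= Ex g.
Proof. by move=> fg; rewrite ler_pM2r ?invr_gt0 ?ltr0n ?card_kout_gt0// ler_sum. Qed.

Lemma Ex_cst c : Ex (fun=> c) = c.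
Proof.
rewrite /Ex sumr_const -[X in X / _]mulr_natr mulfK//.
by rewrite pnatr_eq0 -lt0n card_kout_gt0.
Qed.

Lemma Ex_ge0 f : (forall D, 0 <= f D) -> 0 <= Ex f.
Proof. by move=> f0; rewrite -(Ex_cst 0) le_Ex. Qed.

Lemma ExD f g : Ex (fun D => f D + g D) = Ex f + Ex g.
Proof. by rewrite /Ex big_split mulrDl. Qed.

Lemma ExB f g : Ex (fun D => f D - g D) = Ex f - Ex g.
Proof. by rewrite /Ex sumrB mulrBl. Qed.

Lemma ExZ c f : Ex (fun D => c * f D) = c * Ex f.
Proof. by rewrite /Ex -mulr_sumr mulrA. Qed.

Lemma Ex_sum (I : Type) (r : seq I) (P : pred I) (F : I -> kout n k -> R) :
  Ex (fun D => \sum_(i <- r | P i) F i D) = \sum_(i <- r | P i) Ex (F i).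
Proof. by rewrite /Ex exchange_big mulr_suml. Qed.

Lemma le_norm_Ex f : `|Ex f| <= Ex (fun D => `|f D|).
Proof.
rewrite /Ex normrM [`|_^-1|]ger0_norm ?invr_ge0// ler_wpM2r ?invr_ge0//.
exact: ler_norm_sum.
Qed.

Definition depends_on T A (f : kout n k -> T) :=
  forall D D', {in A, D =1 D'} -> f D = f D'.

Lemma depends_on_comp T T' (h : T -> T') A (f : kout n k -> T) :
  depends_on A f -> depends_on A (fun D => h (f D)).
Proof. by move=> fA D D' /fA ->. Qed.

Let mix A D D' : kout n k := [ffun a => if a \in A then D a else D' a].

(* Swapping the arcs outside A between two independent copies of D is an
   involution. *)
Lemma Ex_indep A f g :
  depends_on A f -> depends_on (~: A) g ->
  Ex (fun D => f D * g D) = Ex f * Ex g.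
Proof.
move=> fA gA; pose N : R := #|{: kout n k}|%:R.
have N0 : N != 0 by rewrite pnatr_eq0 -lt0n card_kout_gt0.
suff : (\sum_D f D) * (\sum_D g D) = (\sum_D f D * g D) * N.
  rewrite /Ex -/N => E; apply: (mulIf N0); apply: (mulIf N0).
  by rewrite divfK// -E; field.
pose h (p : kout n k * kout n k) := (mix A p.1 p.2, mix A p.2 p.1).
have hK : involutive h.
  by move=> [D D2]; rewrite /h/=; congr (_, _); apply: kout_ext => a;
    rewrite /mix !ffunE; case: (a \in A).
transitivity (\sum_(p : kout n k * kout n k) f p.1 * g p.2).
  rewrite [LHS]mulr_suml; under eq_bigr do rewrite mulr_sumr.
  by rewrite pair_big.
transitivity (\sum_(p : kout n k * kout n k) f p.1 * g p.1); last first.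
  rewrite -(pair_big predT predT (fun D _ => f D * g D))/=.
  rewrite [RHS]mulr_suml; apply: eq_bigr => D _.
  by rewrite sumr_const -[LHS]mulr_natr.
rewrite [LHS](reindex_inj (inv_inj hK)); apply: eq_bigr => -[D D'] _ /=.
congr (_ * _).
- by apply: fA => a aA; rewrite ffunE aA.
- by apply: gA => a; rewrite inE ffunE => /negbTE ->.
Qed.

(** Exchanging the values [v] and [w] in all endpoints is an involution of the sample space, so all
    endpoints of [a] are equally likely; their [n] probabilities add up to 1. *)
Lemma Ex_arc (a : 'I_n * 'I_k) (v : 'I_n) :
  Ex (fun D => (D a == v)%:R) = n%:R^-1.
Proof.
have E w : Ex (fun D => (D a == w)%:R) = Ex (fun D => (D a == v)%:R).
  rewrite /Ex; congr (_ / _).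
  pose h D : kout n k := [ffun b => tperm v w (D b)].
  have hK : involutive h by move=> D; apply: kout_ext => b; rewrite !ffunE tpermK.
  rewrite [LHS](reindex_inj (inv_inj hK)); apply: eq_bigr => D _.
  rewrite ffunE; suff -> : (tperm v w (D a) == w) = (D a == v) by [].
  by rewrite -{2}(tpermL v w) (inj_eq perm_inj).
have n0 : (n%:R : R) != 0 by rewrite pnatr_eq0 -lt0n (leq_ltn_trans _ (ltn_ord v)).
apply: (mulfI n0); rewrite mulfV//.
transitivity (Ex (fun D => \sum_w (D a == w)%:R)).
  by rewrite Ex_sum (eq_bigr _ (fun w _ => E w)) sumr_const card_ord -[RHS]mulr_natl.
rewrite -[RHS](Ex_cst 1); apply: eq_Ex => D.
rewrite (bigD1 (D a))//= eqxx big1 ?addr0// => w.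
by rewrite eq_sym => /negbTE ->.
Qed.

Lemma Ex_map (s : seq ('I_n * 'I_k)) (t : seq 'I_n) :
  uniq s -> size s = size t ->
  Ex (fun D => (map D s == t)%:R) = n%:R ^- size s.
Proof.
elim: s t => [|a s IHs] [|v t]//=; first by rewrite expr0 invr1 Ex_cst.
move=> /andP[as_ us] [st].
rewrite -(eq_Ex (f := fun D => (D a == v)%:R * (map D s == t)%:R)); last first.
  by move=> D; rewrite eqseq_cons -natrM mulnb.
rewrite (@Ex_indep [set a]).
- by rewrite Ex_arc IHs// exprS invfM.
- by move=> D D' DD'; rewrite DD'// inE.
- move=> D D' DD'; congr ((_ == t)%:R); apply/eq_in_map => b bs; apply: DD'.
  by rewrite !inE; apply: contraNneq as_ => <-.
Qed.

Lemma le_Ex_map (s : seq ('I_n * 'I_k)) (t : seq 'I_n) :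
  uniq s -> Ex (fun D => (map D s == t)%:R) <= n%:R ^- size s.
Proof.
move=> us; have [st|st] := eqVneq (size s) (size t); first by rewrite Ex_map.
rewrite (eq_Ex (g := fun=> 0)) ?Ex_cst ?invr_ge0 ?exprn_ge0// => D.
by case: eqP => // /(congr1 size); rewrite size_map => /eqP; rewrite (negPf st).
Qed.

End Expectation.

(** * Analytic estimates *)

Lemma ge0_derive_le (R : realType) (f df : R -> R) (a b : R) :
  a <= b -> (forall x, a <= x <= b -> is_derive x 1 f (df x)) ->
  (forall x, a <= x <= b -> 0 <= df x) -> f a <= f b.
Proof.
move=> ab fdf df0.
have [||c] := @MVT_segment R f df a b ab.
- by move=> x; rewrite in_itv/= => /andP[ax xb]; apply: fdf; rewrite !ltW.
- apply: derivable_within_continuous => x; rewrite in_itv/= => axb.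
  by have [] := fdf x axb.
rewrite in_itv/= => acb E; rewrite -subr_ge0 E mulr_ge0 ?subr_ge0//.
exact: df0.
Qed.

Lemma is_derive_pow (R : realType) (f : R -> R) (n : nat) (x df : R) :
  is_derive x 1 f df ->
  is_derive x 1 (fun y => f y ^+ n) (n%:R * f x ^+ n.-1 * df).
Proof.
move=> /(is_deriveX n) H; suff -> : (fun y => f y ^+ n) = f ^+ n by [].
by apply/funext => y; rewrite fctE.
Qed.

Lemma is_derive1B (R : realType) (f g : R -> R) (x a b : R) :
  is_derive x 1 f a -> is_derive x 1 g b ->
  is_derive x 1 (fun y => f y - g y) (a - b).
Proof. exact: is_deriveB. Qed.

Lemma is_derive1D (R : realType) (f g : R -> R) (x a b : R) :
  is_derive x 1 f a -> is_derive x 1 g b ->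
  is_derive x 1 (fun y => f y + g y) (a + b).
Proof. exact: is_deriveD. Qed.

Lemma is_derive1Z (R : realType) (f : R -> R) (c x a : R) :
  is_derive x 1 f a -> is_derive x 1 (fun y => c * f y) (c * a).
Proof. exact: is_deriveZ. Qed.

Lemma gt0_derive_lt (R : realType) (f df : R -> R) (a b : R) :
  a < b -> (forall x, a <= x <= b -> is_derive x 1 f (df x)) ->
  (forall x, a < x < b -> 0 < df x) -> f a < f b.
Proof.
move=> ab fdf df0.
have [||c] := @MVT R f df a b ab.
- by move=> x; rewrite in_itv/= => /andP[ax xb]; apply: fdf; rewrite !ltW.
- apply: derivable_within_continuous => x; rewrite in_itv/= => axb.
  by have [] := fdf x axb.
rewrite in_itv/= => acb E; rewrite -subr_gt0 E mulr_gt0 ?subr_gt0//.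
exact: df0.
Qed.

Lemma is_derive1M (R : realType) (f g : R -> R) (x a b : R) :
  is_derive x 1 f a -> is_derive x 1 g b ->
  is_derive x 1 (fun y => f y * g y) (f x * b + g x * a).
Proof. exact: is_deriveM. Qed.

Lemma is_derive_ln1B (R : realType) (x : R) : x < 1 ->
  is_derive x 1 (fun y => ln (1 - y)) (- (1 - x)^-1).
Proof.
move=> x1; have x0 : 0 < 1 - x by rewrite subr_gt0.
have H := is_derive1_comp (f := @ln R) (g := fun y => 1 - y) (is_derive1_ln x0)
  (is_derive1B (is_derive_cst (1 : R) x 1) (is_derive_id x 1)).
by apply: is_derive_eq; rewrite sub0r mulrN1.
Qed.

(* The number of surjections from a set of size m onto a set of size s. *)
Fixpoint surj (m s : nat) : nat :=
  match m with
  | 0 => s == 0%N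
  | m'.+1 => s * (surj m' s + surj m' s.-1)
  end.

(** The left side is one term of the power series of (e^x - 1)^s, whose terms are nonnegative. The
    induction avoids the series: the derivative of (e^x - 1)^(s+1) is (s+1) ((e^x - 1)^(s+1) + (e^x
    - 1)^s), which matches the recursion of [surj], and the inequality of derivatives is integrated
    from 0. *)
Lemma surj_le (R : realType) (m s : nat) (x : R) : 0 <= x ->
  (surj m s)%:R * (x ^+ m / m`!%:R) <= (expR x - 1) ^+ s.
Proof.
elim: m s x => [|m IHm] s x x0.
  rewrite /= expr0 fact0 divr1 mulr1; case: s => [|s]; first by rewrite expr0.
  by rewrite exprn_ge0// subr_ge0 -expR0 ler_expR.
case: s => [|s]; first by rewrite /= mul0n mul0r expr0.
pose F (y : R) := (expR y - 1) ^+ s.+1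
   - (surj m.+1 s.+1)%:R / m.+1`!%:R * y ^+ m.+1.
pose dF (y : R) := s.+1%:R * (expR y * (expR y - 1) ^+ s)
   - (surj m.+1 s.+1)%:R / m`!%:R * y ^+ m.
suff : F 0 <= F x.
  rewrite /F expR0 subrr !expr0n/= mulr0 subrr subr_ge0.
  by rewrite mulrCA [x ^+ _ * _]mulrC.
have m0 : (m`!%:R : R) != 0 by rewrite pnatr_eq0 -lt0n fact_gt0.
apply: (@ge0_derive_le _ F dF) => // y /andP[y0 _].
  apply: is_derive_eq.
    apply: is_derive1B.
      apply: is_derive_pow.
    by apply: is_derive1Z; apply: is_derive_pow.
  rewrite /dF factS natrM subr0 mulr1/=.
  have : (m.+1%:R : R) != 0 by rewrite pnatr_eq0.
  by move: m0 (surj _ _) => ? ? ?; field; apply/andP.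
have /= := IHm s.+1 y y0; have /= := IHm s y y0.
rewrite /dF subr_ge0 /= => h1 h2.
rewrite natrM natrD -!mulrA ler_wpM2l// mulrDl.
have -> : expR y * (expR y - 1) ^+ s = (expR y - 1) ^+ s.+1 + (expR y - 1) ^+ s.
  by rewrite exprS; ring.
by rewrite ![m`!%:R^-1 * _]mulrC; apply: lerD.
Qed.

(** A weak form of Stirling's formula. The induction step amounts to e (m+1)^(m+2) <= (m+2)^(m+2),
    which is 1 - 1/(m+2) <= exp(-1/(m+2)) raised to the power m+2. *)
Lemma fact_le (R : realType) (m : nat) : (0 < m)%N ->
  m`!%:R <= m%:R * (m%:R / expR 1) ^+ m * expR 1 :> R.
Proof.
case: m => // m _; elim: m => [|m IHm].
  by rewrite expr1 mul1r mul1r mulVf ?gt_eqF ?expR_gt0.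
rewrite factS natrM -mulrA ler_wpM2l//; apply: (le_trans IHm).
have e0 : 0 < expR 1 :> R := expR_gt0 _.
have m0 : 0 < m.+2%:R :> R by rewrite ltr0n.
have h : m.+1%:R * expR (m.+2%:R^-1) <= m.+2%:R :> R.
  have := expR_ge1Dx (- m.+2%:R^-1 : R).
  rewrite expRN -(ler_pM2r (expR_gt0 m.+2%:R^-1)) mulVf ?gt_eqF ?expR_gt0//.
  move=> h; rewrite -(ler_pM2l (_ : 0 < m.+2%:R^-1)) ?invr_gt0// mulVf ?gt_eqF//.
  suff -> : m.+2%:R^-1 * (m.+1%:R * expR m.+2%:R^-1)
    = (1 - m.+2%:R^-1) * expR m.+2%:R^-1 :> R by [].
  rewrite mulrA; congr (_ * _).
  have -> : m.+1%:R = m.+2%:R - 1 :> R by rewrite -[m.+2%:R]natr1 addrK.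
  by rewrite mulrBr mulVf ?gt_eqF// mulr1.
have {h} : m.+1%:R ^+ m.+2 * expR 1 <= m.+2%:R ^+ m.+2 :> R.
  have := lerXn2r m.+2 _ _ h; rewrite !nnegrE exprMn -expRM_natl mulfV ?gt_eqF//.
  by apply => //; rewrite mulr_ge0// expR_ge0.
move=> h; rewrite ler_wpM2r ?(ltW e0)// !expr_div_n.
rewrite mulrA -exprS ler_pdivrMr ?exprn_gt0// -mulrA.
rewrite [X in _ * X](_ : _ = (expR 1)^-1); first by rewrite ler_pdivlMr.
by rewrite [expR 1 ^+ m.+2]exprS invfM -mulrA mulVf ?mulr1// expf_neq0// gt_eqF.
Qed.

(** This is one term of the binomial expansion of ((1 - a) + a)^n. *)
Lemma binomial_le (R : realType) (n s : nat) (a : R) : 0 <= a <= 1 -> (s <= n)%N ->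
  'C(n, s)%:R * (a ^+ s * (1 - a) ^+ (n - s)) <= 1.
Proof.
move=> /andP[a0 a1] sn; have b0 : 0 <= 1 - a by rewrite subr_ge0.
apply: (@le_trans _ _ (((1 - a) + a) ^+ n)); last by rewrite subrK expr1n.
rewrite [leRHS]exprDn (bigD1 (inord s))//= inordK ?ltnS// mulr_natl [a ^+ s * _]mulrC.
by rewrite lerDl sumr_ge0// => i _; rewrite mulrn_wge0// mulr_ge0 ?exprn_ge0.
Qed.

Lemma geometric_tail (R : realType) (r : R) (K N : nat) : 0 <= r < 1 ->
  \sum_(K <= s < N) r ^+ s <= r ^+ K / (1 - r).
Proof.
move=> /andP[r0 r1]; have d0 : 0 < 1 - r by rewrite subr_gt0.
have [NK|KN] := leqP N K.
  by rewrite big_geq// divr_ge0 ?exprn_ge0// ltW.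
rewrite ler_pdivlMr// mulr_suml.
under eq_bigr do rewrite mulrBr mulr1 -exprSr -opprB.
rewrite sumrN telescope_sumr; last exact: ltnW.
by rewrite opprB lerBlDr lerDl exprn_ge0.
Qed.

Lemma geometric_small (R : realType) (r e : R) : 0 <= r < 1 -> 0 < e ->
  exists K : nat, r ^+ K <= e.
Proof.
move=> /andP[r0 r1] e0.
have /cvgrPdist_le/(_ e e0)[K _ HK] : (r ^+ n @[n --> \oo] --> (0 : R))%classic.
  by apply: cvg_expr; rewrite ger0_norm.
by exists K; have := HK K (leqnn K); rewrite sub0r normrN ger0_norm ?exprn_ge0.
Qed.

(** * The constant tau, the rate function and the sum over sizes *)

Section Tau.
Variables (R : realType) (k : nat) (tau : R).
Hypotheses (hk : (2 <= k)%N) (htau : is_tau k tau).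

(** The limiting proportion of vertices in the giant. *)
Definition nu := tau / k%:R.

Let k2 : 2 <= k%:R :> R. Proof. by rewrite (ler_nat R 2 k). Qed.
Let k0 : 0 < k%:R :> R. Proof. exact: lt_le_trans k2. Qed.
Let kne0 : k%:R != 0 :> R. Proof. by rewrite gt_eqF. Qed.

Lemma tau_gt0 : 0 < tau. Proof. by case: htau. Qed.

Lemma tauE : tau = k%:R * nu. Proof. by rewrite /nu; field. Qed.

Lemma nu_gt0 : 0 < nu. Proof. by rewrite divr_gt0 ?tau_gt0. Qed.

Lemma expRNtau : expR (- tau) = 1 - nu.
Proof. by case: htau; rewrite -/nu => _ h; lra. Qed.

Lemma nu_lt1 : nu < 1.
Proof. by have := expR_gt0 (- tau); rewrite expRNtau; lra. Qed.

(** Subcriticality outside the giant: a vertex has on average less than one out-arc that ends there.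
    Multiplying e^tau > 1 + tau by e^(-tau) = 1 - nu gives (1 - nu)(1 + k nu) < 1, and one divides
    by nu. *)
Lemma k1nu_lt1 : k%:R * (1 - nu) < 1.
Proof.
have := expR_gt1Dx (lt0r_neq0 tau_gt0).
rewrite -(ltr_pM2l (expR_gt0 (- tau))) -expRD addNr expR0 expRNtau tauE => h.
have := nu_gt0; have := k0; set K : R := k%:R in h * => K0 n0.
by rewrite -(ltr_pM2l n0); nra.
Qed.

Lemma nu_gt_half : 2^-1 < nu.
Proof. by have := k1nu_lt1; have := nu_lt1; have := k2; nra. Qed.

Lemma ln_1Bnu : ln (1 - nu) = - tau.
Proof. by rewrite -expRNtau expRK. Qed.

(** The strictly convex function e^(-kx) takes the values 1 and 1 - nu at 0 and nu, so between them
    it lies below the chord 1 - x. In the proof, [h0] and [h1] say that the tangent at [a] is below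
    the curve at 0 and at nu; they are averaged with weights nu - a and a. *)
Lemma ln_gt_Nk (a : R) : 0 < a < nu -> - (k%:R * a) < ln (1 - a).
Proof.
move=> /andP[a0 an]; have n1 := nu_lt1.
rewrite -ltr_expR lnK ?posrE; last by lra.
set p := expR _; have p0 : 0 < p := expR_gt0 _.
have h0 : p * (1 + k%:R * a) < 1.
  rewrite [ltRHS](_ : _ = p * expR (k%:R * a)); last first.
    by rewrite /p -expRD addNr expR0.
  by rewrite ltr_pM2l// expR_gt1Dx// mulf_neq0// gt_eqF.
have h1 : p * (1 - k%:R * (nu - a)) < 1 - nu.
  have -> : 1 - nu = p * expR (- (k%:R * (nu - a))).
    by rewrite -expRNtau /p -expRD; congr expR; rewrite tauE; ring.
  by rewrite ltr_pM2l// expR_gt1Dx// oppr_eq0 mulf_neq0// subr_eq0 gt_eqF.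
rewrite -(ltr_pM2l nu_gt0).
have h2 : 0 < nu - a by lra.
have := ltr_pM2l h2 (p * (1 + k%:R * a)) 1; rewrite h0 => /idP h3.
have := ltr_pM2l a0 (p * (1 - k%:R * (nu - a))) (1 - nu); rewrite h1 => /idP h4.
have -> : nu * p = (nu - a) * (p * (1 + k%:R * a)) +
  a * (p * (1 - k%:R * (nu - a))) by ring.
by lra.
Qed.

(** Past nu, e^(-kx) lies above its tangent at nu, whose slope -k (1 - nu) is greater than -1 by
    [k1nu_lt1]; hence it lies above 1 - x. *)
Lemma ln_lt_Nk (a : R) : nu < a < 1 -> ln (1 - a) < - (k%:R * a).
Proof.
move=> /andP[an a1].
rewrite -ltr_expR lnK ?posrE; last by lra.
have n0 : 0 < 1 - nu by have := nu_lt1; lra.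
have -> : expR (- (k%:R * a)) = (1 - nu) * expR (- (k%:R * (a - nu))).
  by rewrite -expRNtau -expRD; congr expR; rewrite tauE; ring.
have d0 : 0 < a - nu by lra.
have h : (1 - nu) * (1 + - (k%:R * (a - nu))) < (1 - nu) * expR (- (k%:R * (a - nu))).
  by rewrite ltr_pM2l// expR_gt1Dx// oppr_eq0 mulf_neq0// gt_eqF.
have := ltr_pM2r d0 (k%:R * (1 - nu)) 1; rewrite k1nu_lt1 => /idP.
lra.
Qed.

(* [n * a * rate a] is the exponential order, for s = a n, of the expected
   number of closed sets of size s all of whose vertices are hit from inside. *)
Definition rate (a : R) : R :=
  (k%:R - 1) * (ln a - ln nu) - (a^-1 - 1) * ln (1 - a) - k%:R * (1 - nu).

Lemma rate_nu : rate nu = 0.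
Proof.
have n0 := nu_gt0.
rewrite /rate subrr mulr0 sub0r ln_1Bnu tauE.
by field; rewrite gt_eqF.
Qed.

(** By [ln_gt_Nk] and [ln_lt_Nk] the numerator is positive before nu and negative after it. *)
Lemma is_derive_rate (a : R) : 0 < a < 1 ->
  is_derive a 1 rate ((k%:R * a + ln (1 - a)) / a ^+ 2).
Proof.
move=> /andP[a0 a1].
have an0 : id a != 0 by rewrite gt_eqF.
have cst_ c := is_derive_cst (c : R) a 1.
apply: (is_derive_eq (is_derive1B (is_derive1B
  (is_derive1Z (k%:R - 1) (is_derive1B (is_derive1_ln a0) (cst_ (ln nu))))
  (is_derive1M (is_derive1B (is_deriveV an0 (is_derive_id a 1)) (cst_ 1))
    (is_derive_ln1B a1))) (cst_ (k%:R * (1 - nu))))).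
rewrite /GRing.scale/=; move: (ln _) => l.
by field; rewrite !gt_eqF//; lra.
Qed.

Lemma rate_incr (a b : R) : 0 < a -> a < b -> b <= nu -> rate a < rate b.
Proof.
move=> a0 ab bn.
have dr x : a <= x <= b -> is_derive x 1 rate ((k%:R * x + ln (1 - x)) / x ^+ 2).
  by move=> /andP[ax xb]; apply: is_derive_rate; have := nu_lt1; lra.
apply: (gt0_derive_lt ab dr) => x /andP[ax xb].
rewrite divr_gt0 ?exprn_gt0//; last by lra.
by have := @ln_gt_Nk x; lra.
Qed.

Lemma rate_decr (a b : R) : nu <= a -> a < b -> b < 1 -> rate b < rate a.
Proof.
move=> na ab b1; have n0 := nu_gt0.
rewrite -[ltLHS]opprK -[ltRHS]opprK ltrN2.
have dr x : a <= x <= b -> is_derive x 1 (fun y => - rate y)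
    (- ((k%:R * x + ln (1 - x)) / x ^+ 2)).
  by move=> /andP[ax xb]; apply: is_deriveN; apply: is_derive_rate; lra.
apply: (gt0_derive_lt ab dr) => x /andP[ax xb].
rewrite -mulNr divr_gt0 ?exprn_gt0//; last by lra.
by have := @ln_lt_Nk x; lra.
Qed.

(** The point 1 is treated apart, since [is_derive_rate] stops before it. The bound ln(1/nu) <= 1/nu
    - 1 reduces the claim to k - 1 < k nu, which is [k1nu_lt1]. *)
Lemma rate1_lt0 : rate 1 < 0.
Proof.
rewrite /rate invr1 subrr mul0r subr0 subr_lt0 ln1 sub0r -lnV ?posrE ?nu_gt0//.
have n0 := nu_gt0; have n1 := nu_lt1; have kn := k1nu_lt1.
have h : ln nu^-1 <= nu^-1 - 1.
  have -> : ln nu^-1 = ln (1 + (nu^-1 - 1)) by congr ln; ring.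
  apply: le_ln1Dx; have : 0 < nu^-1 by rewrite invr_gt0.
  by lra.
have h1 : (k%:R - 1) * ln nu^-1 <= (k%:R - 1) * (nu^-1 - 1).
  rewrite ler_wpM2l//.
  by have := k2; lra.
apply: (le_lt_trans h1); rewrite -(ltr_pM2r n0).
have -> : (k%:R - 1) * (nu^-1 - 1) * nu = (k%:R - 1) * (1 - nu).
  by field; rewrite gt_eqF.
rewrite mulrAC ltr_pM2r; lra.
Qed.

Lemma rate_le (eps : R) : 0 < eps -> exists2 c : R, 0 < c &
  forall a, 0 < a <= 1 -> eps <= `|a - nu| -> rate a <= - c.
Proof.
move=> e0; have n0 := nu_gt0; have n1 := nu_lt1.
(* By monotonicity the rate is largest at the edges nu - eps and nu + eps. When an edge falls
   outside the interval no [a] below 1 lies on that side, and the value 1 only keeps the minimum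
   positive. *)
pose c1 := if 0 < nu - eps then - rate (nu - eps) else 1.
pose c2 := if nu + eps < 1 then - rate (nu + eps) else 1.
exists (Num.min (- rate 1) (Num.min c1 c2)).
  rewrite !lt_min oppr_gt0 rate1_lt0/=; apply/andP; split.
    rewrite /c1; case: ifP => // h; rewrite oppr_gt0 -rate_nu rate_incr//; lra.
  rewrite /c2; case: ifP => // h; rewrite oppr_gt0 -rate_nu rate_decr//; lra.
move=> a /andP[a0 a1] ea; rewrite lerNr !ge_min.
have [a_nu|a_nu] := leP nu a.
  rewrite ger0_norm ?subr_ge0// in ea.
  have [aE|aN] := eqVneq a 1; first by rewrite aE lexx.
  have {aN}a1 : a < 1 by rewrite lt_neqAle aN.
  have h : nu + eps < 1 by lra.
  rewrite /c2 h !lerN2.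
  have [<-|ne] := eqVneq (nu + eps) a; first by rewrite lexx !orbT.
  by rewrite (ltW (@rate_decr (nu + eps) a _ _ _)) ?orbT//; move/eqP: ne; lra.
rewrite ltr0_norm ?subr_lt0// in ea.
have h : 0 < nu - eps by lra.
rewrite /c1 h !lerN2.
have [->|ne] := eqVneq a (nu - eps); first by rewrite lexx !orbT.
by rewrite (ltW (@rate_incr a (nu - eps) _ _ _)) ?orbT//; move/eqP: ne; lra.
Qed.

(** Combines [surj_le] at x = tau, [fact_le] for (sk)! and [binomial_le] at a = s/n. The point tau
    minimizes (e^x - 1)^s / x^(ks) for every s at once: the critical equation is x = k (1 -
    e^(-x)). *)
Lemma surj_rate (n s : nat) : (0 < s <= n)%N ->
  'C(n, s)%:R * ((surj (s * k) s)%:R / n%:R ^+ (s * k)) <=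
  expR 1 * (s * k)%:R * expR (s%:R * rate (s%:R / n%:R)) :> R.
Proof.
move=> /andP[s0 sn]; set m := (s * k)%N.
have m0 : (0 < m)%N by rewrite muln_gt0 s0/= (leq_trans _ hk).
have sR : 0 < s%:R :> R by rewrite ltr0n.
have nR : 0 < n%:R :> R by rewrite ltr0n (leq_trans s0).
have t0 := tau_gt0; have n0 := nu_gt0; have e0 := expR_gt0 (1 : R).
set a := s%:R / n%:R.
have a0 : 0 < a by rewrite divr_gt0.
have a1 : a <= 1 by rewrite ler_pdivrMr// mul1r ler_nat.
have hS : (surj m s)%:R / n%:R ^+ m <=
    m%:R * expR 1 * (expR (- 1) * (a / nu)) ^+ m * (expR tau * nu) ^+ s.
  have := surj_le m s (ltW t0).
  have -> : expR tau - 1 = expR tau * nu.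
    by rewrite -[nu in RHS](subKr 1) -expRNtau mulrBr -expRD subrr expR0 mulr1.
  rewrite mulrA ler_pdivrMr ?ltr0n ?fact_gt0// => h.
  rewrite ler_pdivrMr ?exprn_gt0// -(ler_pM2r (exprn_gt0 m t0)).
  apply: (le_trans h); set y := (_ * nu) ^+ s.
  have y0 : 0 <= y by rewrite exprn_ge0// mulr_ge0 ?expR_ge0// ltW.
  have -> : m%:R * expR 1 * (expR (- 1) * (a / nu)) ^+ m * y * n%:R ^+ m * tau ^+ m
      = y * (m%:R * (m%:R / expR 1) ^+ m * expR 1).
    have -> : m%:R / expR 1 = expR (- 1) * (a / nu) * n%:R * tau :> R.
      rewrite /m /a natrM expRN tauE; field.
      by rewrite !gt_eqF.
    by rewrite [in RHS]exprMn [in RHS]exprMn; ring.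
  by rewrite ler_wpM2l// fact_le.
have hC : 'C(n, s)%:R <= expR (- (s%:R * ln a) - s%:R * ((a^-1 - 1) * ln (1 - a))).
  have E : a ^+ s * (1 - a) ^+ (n - s) =
      expR (s%:R * ln a + s%:R * ((a^-1 - 1) * ln (1 - a))).
    rewrite expRD expRM_natl lnK ?posrE//; congr (_ * _).
    (* For s = n the logarithm is taken at 0, where it has a default value, but its coefficient 1/a
       - 1 vanishes. *)
    have [sE|sN] := eqVneq s n.
      by rewrite /a sE subnn expr0 divff ?gt_eqF// invr1 subrr mul0r mulr0 expR0.
    have a1' : 0 < 1 - a.
      by rewrite subr_gt0 ltr_pdivrMr// mul1r ltr_nat ltn_neqAle sN.
    have -> : s%:R * ((a^-1 - 1) * ln (1 - a)) = (n - s)%:R * ln (1 - a).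
      rewrite mulrA; congr (_ * _); rewrite natrB// /a; field.
      by rewrite !gt_eqF.
    by rewrite expRM_natl lnK ?posrE.
  have := @binomial_le R n s a; rewrite (ltW a0) a1 => /(_ isT sn).
  by rewrite E -ler_pdivlMr ?expR_gt0// div1r -expRN opprD.
apply: (le_trans (ler_pM _ _ hC hS)) => //.
have XY : (expR (-1) * (a / nu)) ^+ m * (expR tau * nu) ^+ s =
   expR (s%:R * (k%:R * (-1 + (ln a - ln nu)) + (tau + ln nu))).
  rewrite -ln_div ?posrE// [RHS]expRM_natl /m mulnC exprM -exprMn; congr (_ ^+ _).
  by rewrite expRD expRM_natl !expRD !lnK ?posrE// divr_gt0.
rewrite [leLHS](_ : _ = expR 1 * m%:R *
  (expR (- (s%:R * ln a) - s%:R * ((a^-1 - 1) * ln (1 - a))) *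
   ((expR (-1) * (a / nu)) ^+ m * (expR tau * nu) ^+ s))); last by ring.
rewrite XY -expRD le_eqVlt; apply/orP; left; apply/eqP; congr (_ * expR _).
by rewrite /rate tauE; ring.
Qed.

(** Serves for bounded [s], where a bound of the form s e^(-cs) does not tend to 0 with n. One has
    C(n, s) <= n^s, while sk >= s + 1 because k >= 2. *)
Lemma surj_small (n s : nat) : (0 < s <= n)%N ->
  'C(n, s)%:R * ((surj (s * k) s)%:R / n%:R ^+ (s * k)) <=
  (surj (s * k) s)%:R / n%:R :> R.
Proof.
move=> /andP[s0 sn]; have n0 : 0 < n%:R :> R by rewrite ltr0n (leq_trans s0).
rewrite mulrCA ler_wpM2l// ler_pdivrMr ?exprn_gt0//.
have h : 'C(n, s)%:R <= n%:R ^+ s :> R.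
  rewrite -natrX ler_nat (@leq_trans (n ^_ s))//.
    by rewrite -bin_ffact leq_pmulr// fact_gt0.
  elim: s {s0 sn} => [|s IHs]; first by rewrite ffactn0.
  by rewrite ffactnSr expnSr leq_mul// leq_subr.
apply: (le_trans h).
rewrite -[X in _ * _ ^+ X]prednK; last by rewrite muln_gt0 s0 (leq_trans _ hk).
rewrite exprS mulKf ?gt_eqF// ler_weXn2l//; first by rewrite ler1n (leq_trans s0).
by move: hk; nia.
Qed.

(** The sum is cut at a constant K: the sizes up to K contribute at most B/n by [surj_small], the
    others a geometric tail by [surj_rate] and [rate_le]. Each part is at most eta/2. *)
Lemma surj_sum_small (eps eta : R) : 0 < eps -> 0 < eta ->
  exists N : nat, forall n, (N <= n)%N ->
  \sum_(1 <= s < n.+1 | eps <= `|s%:R / n%:R - nu|)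
    'C(n, s)%:R * ((surj (s * k) s)%:R / n%:R ^+ (s * k)) <= eta.
Proof.
move=> eps0 eta0; have [c c0 Hc] := rate_le eps0.
(* Half of the decay e^(-cs) = r^s r^s absorbs the linear factor, as s c/2 <= e^(s c/2) gives s r^s
   <= 2/c; the other half is summed. *)
pose r := expR (- (c / 2)); pose C := expR 1 * k%:R * (2 / c).
have r0 : 0 < r := expR_gt0 _.
have r1 : r < 1 by rewrite expR_lt1 oppr_lt0 divr_gt0.
have C0 : 0 < C by rewrite !mulr_gt0 ?expR_gt0 ?invr_gt0.
have [||K HK] := @geometric_small R r (eta / 2 * (1 - r) / C).
- by rewrite (ltW r0).
- by rewrite divr_gt0 ?mulr_gt0 ?subr_gt0 ?invr_gt0.
pose B : R := \sum_(1 <= s < K.+1) (surj (s * k) s)%:R.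
have B0 : 0 <= B by rewrite sumr_ge0.
pose N := (Num.truncn (B / (eta / 2))).+1.
exists (maxn N K.+1) => n; rewrite geq_max => /andP[Nn Kn].
have nR : 0 < n%:R :> R by rewrite ltr0n (leq_trans _ Kn).
rewrite (@big_cat_nat _ _ _ K.+1)//=; last by rewrite ltnS ltnW.
rewrite [leRHS](_ : _ = eta / 2 + eta / 2); last by field.
apply: lerD.
  apply: (@le_trans _ _ (B / n%:R)).
    rewrite /B mulr_suml big_mkcond; apply: ler_sum_nat => s /andP[s0 sK].
    case: ifP => _; last by rewrite divr_ge0.
    by apply: surj_small; rewrite s0/= (leq_trans _ Kn)// ltnW.
  rewrite ler_pdivrMr// mulrC -ler_pdivrMr ?divr_gt0//.
  apply: (le_trans (ltW (truncnS_gt _))).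
  by rewrite ler_nat.
apply: (@le_trans _ _ (\sum_(K <= s < n.+1) C * r ^+ s)).
  rewrite [leRHS]big_ltn; last by rewrite ltnS ltnW.
  rewrite -[leLHS]add0r lerD//; first by rewrite mulr_ge0 ?exprn_ge0 ?ltW.
  rewrite big_mkcond; apply: ler_sum_nat => s /andP[sK sn].
  have s0 : (0 < s)%N by rewrite (leq_trans _ sK).
  case: ifP => [es|_]; last by rewrite mulr_ge0 ?exprn_ge0 ?ltW.
  have sR : 0 < s%:R :> R by rewrite ltr0n.
  apply: (le_trans (@surj_rate n s _)); first by rewrite s0.
  have hr : rate (s%:R / n%:R) <= - c.
    by apply: Hc => //; rewrite divr_gt0//= ler_pdivrMr// mul1r ler_nat.
  apply: (@le_trans _ _ (expR 1 * (s * k)%:R * expR (s%:R * - c))).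
    by rewrite ler_wpM2l ?mulr_ge0 ?expR_ge0// ler_expR ler_wpM2l.
  have -> : expR (s%:R * - c) = r ^+ s * r ^+ s.
    by rewrite /r -!expRM_natl -expRD; congr expR; field.
  rewrite /C natrM -!mulrA ler_wpM2l ?expR_ge0// [leLHS]mulrCA ler_wpM2l//.
  rewrite mulrA mulrA ler_wpM2r ?exprn_ge0 ?(ltW r0)//.
  rewrite -ler_pdivlMr ?exprn_gt0// -ler_pdivrMl ?divr_gt0//.
  rewrite invf_div.
  have -> : (r ^+ s)^-1 = expR (s%:R * (c / 2)).
    by rewrite /r -expRM_natl -expRN; congr expR; ring.
  apply: le_trans (expR_ge1Dx _).
  by rewrite [leLHS]mulrC; lra.
rewrite -mulr_sumr; apply: (@le_trans _ _ (C * (r ^+ K / (1 - r)))).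
  by rewrite ler_wpM2l ?(ltW C0)// geometric_tail// ltW.
by rewrite mulrA ler_pdivrMr ?subr_gt0// mulrC -ler_pdivlMr.
Qed.

End Tau.

(** * Closed components and the giant *)

Section ClosedComponents.
Variables (n k : nat).
Implicit Types (D : kout n k) (S T C U : {set 'I_n}).

Definition out_arcs S : {set 'I_n * 'I_k} := [set a | a.1 \in S].

Lemma card_out_arcs S : #|out_arcs S| = (#|S| * k)%N.
Proof.
have -> : out_arcs S = finset.setX S [set: 'I_k].
  by apply/finset.setP => -[v i]; rewrite !inE andbT.
by rewrite cardsX cardsT card_ord.
Qed.

Lemma closed_setP D S :
  reflect (forall a, a.1 \in S -> D a \in S) (closed_set D S).
Proof.
by apply: (iffP fintype.forallP) => H a; [exact/implyP/H|apply/implyP/H].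
Qed.

Lemma adj_out D a : adj D a.1 (D a).
Proof. by apply/fintype.existsP; exists a.2; rewrite -surjective_pairing. Qed.

Lemma adjP D u v : reflect (exists i, D (u, i) = v) (adj D u v).
Proof. by apply: (iffP fintype.existsP) => -[i /eqP]; exists i => //; apply/eqP. Qed.

Lemma closed_path D S v p :
  closed_set D S -> v \in S -> path (adj D) v p -> last v p \in S.
Proof.
move=> /closed_setP clS; elim: p v => //= w p IHp v vS /andP[/adjP[i <-]].
by apply: IHp; exact: (clS (v, i)).
Qed.

Lemma closed_connect D S v w :
  closed_set D S -> v \in S -> connect (adj D) v w -> w \in S.
Proof. by move=> clS vS /connectP[p vp ->]; exact: closed_path vp. Qed.

(** A path that starts in a closed set never leaves it, so it uses only arcs that start in the
    set. *)
Lemma connect_out_arcs D D' S v w : {in out_arcs S, D =1 D'} ->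
  closed_set D S -> v \in S -> connect (adj D) v w -> connect (adj D') v w.
Proof.
move=> DD' clS vS /connectP[p + ->]; elim: p v vS => [|u p IHp] v vS /=.
  by rewrite connect0.
move=> /andP[/adjP[i iu] up].
have uS : u \in S by rewrite -iu; apply: (closed_setP _ _ clS (v, i)).
apply: connect_trans (IHp u uS up); apply: connect1; apply/adjP.
by exists i; rewrite -DD' ?inE.
Qed.

Lemma closed_sccsP D S :
  reflect (exists2 v, S = scc D v & closed_set D S) (S \in closed_sccs D).
Proof.
rewrite inE; apply: (iffP andP) => [[/fintype.existsP[v /eqP Sv] clS]|[v Sv clS]].
  by exists v.
by split=> //; apply/fintype.existsP; exists v; apply/eqP.
Qed.

Lemma scc_id D v : v \in scc D v.
Proof. by rewrite inE connect0. Qed.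

Lemma scc_eq D u v : u \in scc D v -> scc D u = scc D v.
Proof.
rewrite inE => /andP[vu uv]; apply/finset.setP => w; rewrite !inE.
by apply/andP/andP => -[h1 h2]; split;
  [exact: connect_trans vu h1|exact: connect_trans h2 uv
  |exact: connect_trans uv h1|exact: connect_trans h2 vu].
Qed.

Lemma closed_sccs_sub D D' S : {in out_arcs S, D =1 D'} ->
  S \in closed_sccs D -> S \in closed_sccs D'.
Proof.
move=> DD' /closed_sccsP[v Sv clS].
have vS : v \in S by rewrite Sv scc_id.
have clS' : closed_set D' S.
  by apply/closed_setP => a aS; rewrite -DD' ?inE//; exact: (closed_setP _ _ clS).
have D'D : {in out_arcs S, D' =1 D} by move=> a /DD'.
apply/closed_sccsP; exists v => //; apply/finset.setP => w; rewrite inE.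
apply/idP/andP => [wS|[vw _]]; last exact: closed_connect vw.
have := wS; rewrite {1}Sv inE => /andP[vw wv].
by split; [exact: connect_out_arcs DD' clS vS vw|exact: connect_out_arcs DD' clS wS wv].
Qed.

Lemma depends_on_closed_sccs S :
  depends_on (out_arcs S) (fun D => S \in closed_sccs D).
Proof.
move=> D D' DD'; apply/idP/idP; first exact: closed_sccs_sub.
by apply: closed_sccs_sub => a /DD'.
Qed.

(** Take a vertex [v] that reaches as few vertices as possible. Whatever [v] reaches has the same
    reachable set, so it reaches [v] back. *)
Lemma exists_closed_scc D : (0 < n)%N -> exists S, S \in closed_sccs D.
Proof.
move=> n0; pose r v := [set w | connect (adj D) v w].
case: (@arg_minnP _ (Ordinal n0) predT (fun v => #|r v|) isT) => v _ vmin.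
exists (scc D v); apply/closed_sccsP; exists v => //; apply/closed_setP => a.
rewrite !inE => /andP[va av].
have vDa : connect (adj D) v (D a).
  by apply: connect_trans va _; apply: connect1; exact: adj_out.
rewrite vDa/=; suff : v \in r (D a) by rewrite inE.
suff -> : r (D a) = r v by rewrite inE connect0.
apply/eqP; rewrite eqEcard vmin// andbT; apply/fintype.subsetP => w.
by rewrite !inE; exact: connect_trans vDa.
Qed.

Lemma closed_sccs_trivI D S T :
  S \in closed_sccs D -> T \in closed_sccs D -> ~~ [disjoint S & T] -> S = T.
Proof.
move=> /closed_sccsP[u -> _] /closed_sccsP[v -> _] /pred0Pn[w /andP[wu wv]].
by rewrite -(scc_eq wu) -(scc_eq wv).
Qed.

(** Any other closed component is disjoint from [S], hence smaller, so there is no tie to break. *)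
Lemma giantE D S : S \in closed_sccs D -> (n < 2 * #|S|)%N -> giant D = S.
Proof.
move=> SD nS.
have lE C : (C \in largest_closed_sccs D) = (C == S).
  have smaller T : T \in closed_sccs D -> T != S -> (#|T| < #|S|)%N.
    move=> TD TS; have /eqP dTS : [disjoint T & S].
      by apply: contraNT TS => /(closed_sccs_trivI TD SD) ->.
    have := cardsUI T S; rewrite (_ : T :&: S = finset.set0); last first.
      by apply/eqP; rewrite finset.setI_eq0; apply/eqP.
    have : (#|T :|: S| <= n)%N by rewrite -[leqRHS]card_ord max_card.
    by rewrite cards0; lia.
  rewrite inE; apply/andP/eqP => [[CD /fintype.forallP H]|->].
    apply/eqP; apply: contraT => /(smaller _ CD).
    by have /implyP/(_ SD) := H S; rewrite leqNgt => /negbTE ->.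
  split=> //; apply/fintype.forallP => T; apply/implyP => TD.
  by have [->//|/(smaller _ TD)/ltnW] := eqVneq T S.
rewrite /giant (bigD1 S)/=; last first.
  rewrite lE eqxx/=; have /closed_sccsP[v Sv _] := SD.
  have vS : v \in S by rewrite Sv scc_id.
  apply/fintype.existsP.
  case: (@arg_minnP _ v (mem S) (@nat_of_ord n) vS) => w wS wmin.
  exists w; rewrite (_ : w \in S)//.
  apply/fintype.forallP => T; apply/implyP; rewrite lE => /eqP ->.
  by apply/fintype.forallP => u; apply/implyP; exact: wmin.
rewrite big1 ?finset.setU0// => C /andP[/andP[]].
by rewrite lE => /eqP ->; rewrite eqxx.
Qed.

(** Reduces closed components to surjections: the arcs that start in [S] are mapped by [D] onto
    [S]. *)
Lemma closed_scc_onto D S : (0 < k)%N -> S \in closed_sccs D ->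
  [set x in map D (enum (out_arcs S))] = S.
Proof.
move=> k0 /closed_sccsP[v Sv clS]; have clS' := closed_setP _ _ clS.
apply/finset.setP => w; rewrite inE; apply/mapP/idP => [[a]|wS].
  by rewrite mem_enum inE => aS ->; exact: clS'.
have vS : v \in S by rewrite Sv scc_id.
(* The path to [w] is taken from the endpoint of an arc, not from [v], so that [w] is hit even if
   the path is empty. *)
pose a0 := (v, Ordinal k0); have a0S : a0.1 \in S by [].
have : connect (adj D) (D a0) w.
  have := clS' _ a0S; rewrite {1}Sv inE => /andP[_ h]; apply: connect_trans h _.
  by move: wS; rewrite Sv inE => /andP[].
move=> /connectP[p]; case/lastP: p => [_ /= ->|p u].
  by exists a0; rewrite // mem_enum inE.
rewrite rcons_path last_rcons => /andP[pth /adjP[i iu]] ->.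
exists (last (D a0) p, i) => //; rewrite mem_enum inE.
by apply: closed_path pth => //; exact: clS'.
Qed.

End ClosedComponents.

(** * Size of the giant and transfer to a fixed set *)

Section GiantSize.
Variables (R : realType) (n k : nat).
Implicit Types (D : kout n k) (S T C U : {set 'I_n}).

(** If the first arc ends at [w], the remaining ones must cover exactly [T] or [T] without [w].
    Summing over [w] in [T] gives the recursion of [surj]. *)
Lemma Ex_onto (T : {set 'I_n}) (s : seq ('I_n * 'I_k)) : uniq s ->
  Ex (fun D : kout n k => ([set x in map D s] == T)%:R) <=
  (surj (size s) #|T|)%:R / n%:R ^+ size s :> R.
Proof.
elim: s T => [|a s IHs] T /=.
  move=> _; rewrite expr0 divr1 (eq_Ex (g := fun=> (#|T| == 0%N)%:R)) ?Ex_cst//.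
  move=> D; rewrite cards_eq0 eq_sym; congr ((_ == _)%:R).
move=> /andP[as_ us].
pose img D : {set 'I_n} := [set x in map D s].
have dimg V : depends_on (~: [set a]) (fun D => (img D == V)%:R : R).
  move=> D D' DD'; rewrite /img; congr ((_ == V)%:R); apply/finset.setP => x; rewrite !inE.
  congr (x \in _); apply/eq_in_map => b bs; apply: DD'.
  by rewrite !inE; apply: contraNneq as_ => <-.
have da w : depends_on [set a] (fun D => (D a == w)%:R : R).
  by move=> D D' DD'; rewrite DD'// inE.
apply: (@le_trans _ _ (Ex (fun D => \sum_(w in T) ((D a == w)%:R *
    (img D == T)%:R + (D a == w)%:R * (img D == T :\ w)%:R)))).
  apply: le_Ex => D; case: eqP => [DT|_]; last first.
    by rewrite sumr_ge0// => w _; rewrite addr_ge0.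
  have DT' : T = D a |: img D by rewrite -DT; apply/finset.setP => x; rewrite !inE.
  have DaT : D a \in T by rewrite DT' !inE eqxx.
  rewrite (bigD1 (D a))//= eqxx !mul1r -[leLHS]addr0 lerD//; last first.
    by rewrite sumr_ge0// => w _; rewrite addr_ge0.
  have [Dai|Dai] := boolP (D a \in img D).
    by rewrite [in img D == T]DT' (finset.setUidPr _) ?finset.sub1set// eqxx lerDl.
  have -> : T :\ D a = img D by rewrite DT' finset.setU1K.
  by rewrite eqxx lerDr.
rewrite Ex_sum.
under eq_bigr => w _ do rewrite ExD !(Ex_indep (da w) (dimg _)) Ex_arc.
apply: (@le_trans _ _ (\sum_(w in T) n%:R^-1 *
   ((surj (size s) #|T|)%:R / n%:R ^+ size s +
    (surj (size s) #|T|.-1)%:R / n%:R ^+ size s))).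
  apply: ler_sum => w wT; rewrite -mulrDr ler_wpM2l ?invr_ge0// lerD//.
    exact: IHs.
  have -> : #|T|.-1 = #|T :\ w| by rewrite [in LHS](cardsD1 w) wT.
  exact: IHs.
rewrite sumr_const -[leLHS]mulr_natl natrM natrD exprS invfM -!mulrDl.
by rewrite le_eqVlt; apply/orP; left; apply/eqP; ring.
Qed.

Definition has_closed_scc (W : pred {set 'I_n}) D :=
  [exists S, (S \in closed_sccs D) && W S].

Lemma giant_unique D (W : pred {set 'I_n}) : (forall S, W S -> (n < 2 * #|S|)%N) ->
  (\sum_(S | W S) (S \in closed_sccs D)%:R : R) = (has_closed_scc W D)%:R.
Proof.
move=> HW; have [/fintype.existsP[S /andP[SD WS]]|h] := boolP (has_closed_scc W D).
  rewrite (bigD1 S)//= SD big1 ?addr0// => T /andP[WT TS].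
  case: (boolP (T \in closed_sccs D)) => // TD; move: TS.
  by rewrite -(giantE TD (HW _ WT)) (giantE SD (HW _ WS)) eqxx.
rewrite big1// => S WS; case: (boolP (S \in _)) => // SD.
by move: h; rewrite negb_exists => /fintype.forallP/(_ S); rewrite SD WS.
Qed.

(* Given that a closed component S with more than half of the vertices is
   present, the arcs from outside S are still independent and uniform. *)
Lemma giant_transfer (W : pred {set 'I_n}) (f : {set 'I_n} -> kout n k -> R)
    (B delta : R) :
  (forall S, W S -> (n < 2 * #|S|)%N) ->
  (forall S, depends_on (~: out_arcs k S) (f S)) ->
  (forall S D, `|f S D| <= B) ->
  0 <= delta -> (forall S, W S -> `|Ex (f S)| <= delta) ->
  `|Ex (fun D => f (giant D) D)| <=
  delta + B * Ex (fun D => (~~ has_closed_scc W D)%:R).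
Proof.
move=> HW fdep fB d0 fd.
(* Split according to which [S] in [W] is the giant. The events in the sum exclude each other, so
   their probabilities add up to at most 1; on the remaining event only the bound [B] is
   available. *)
rewrite (eq_Ex (g := fun D => \sum_(S | W S) (S \in closed_sccs D)%:R * f S D +
    (~~ has_closed_scc W D)%:R * f (giant D) D)); last first.
  move=> D; transitivity ((\sum_(S | W S) (S \in closed_sccs D)%:R) * f (giant D) D +
      (~~ has_closed_scc W D)%:R * f (giant D) D).
    by rewrite giant_unique//; case: has_closed_scc; rewrite /= ?mul0r mul1r ?addr0 ?add0r.
  rewrite mulr_suml; congr (_ + _); apply: eq_bigr => S WS.
  case: (boolP (S \in closed_sccs D)) => [SD|_]; last by rewrite !mul0r.
  by rewrite (giantE SD (HW _ WS)).
rewrite ExD (le_trans (ler_normD _ _))//; apply: lerD.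
  rewrite Ex_sum (le_trans (ler_norm_sum _ _ _))//.
  apply: (@le_trans _ _ (\sum_(S | W S) Ex (fun D => (S \in closed_sccs D)%:R) * delta)).
    apply: ler_sum => S WS.
    rewrite (Ex_indep (depends_on_comp (fun b : bool => b%:R : R)
      (@depends_on_closed_sccs n k S)) (fdep S)) normrM.
    by rewrite ger0_norm ?Ex_ge0// ler_wpM2l ?Ex_ge0// fd.
  rewrite -mulr_suml -Ex_sum -[leRHS]mul1r ler_wpM2r//.
  rewrite -[leRHS](@Ex_cst R n k); apply: le_Ex => D.
  by rewrite giant_unique//; case: has_closed_scc.
rewrite (le_trans (le_norm_Ex _))// -ExZ; apply: le_Ex => D.
by rewrite normrM [leRHS]mulrC ger0_norm// ler_wpM2l.
Qed.

Lemma sum_by_card (F : nat -> R) :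
  \sum_(S : {set 'I_n}) F #|S| = \sum_(0 <= s < n.+1) 'C(n, s)%:R * F s.
Proof.
rewrite big_mkord (partition_big (fun S : {set 'I_n} => inord #|S| : 'I_n.+1) predT)//=.
apply: eq_bigr => s _.
rewrite (eq_bigl (fun S : {set 'I_n} => #|S| == s)); last first.
  move=> S; have cS : (#|S| < n.+1)%N by rewrite ltnS -[leqRHS]card_ord max_card.
  by rewrite -val_eqE/= inordK.
rewrite (eq_bigr (fun=> F s)); last by move=> S /eqP ->.
rewrite sumr_const -[LHS]mulr_natl; congr (_%:R * _).
have := card_draws 'I_n s; rewrite card_ord => <-.
by apply: eq_card => S; rewrite inE.
Qed.

End GiantSize.

Definition size_window (R : realType) (n : nat) (c eps : R) : pred {set 'I_n} :=
  fun S => `|#|S|%:R / n%:R - c| < eps.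

(** A closed component always exists. If none has its size in the window, then some nonempty [S] of
    another size is the exact image of its own arcs; a union bound over [S] leads to
    [surj_sum_small]. *)
Lemma giant_size (R : realType) (k : nat) (tau eps eta : R) :
  (2 <= k)%N -> is_tau k tau -> 0 < eps -> 0 < eta ->
  exists N : nat, forall n, (N <= n)%N ->
  Ex (fun D : kout n k => (~~ has_closed_scc
    (size_window (nu k tau) eps) D)%:R) <= eta.
Proof.
move=> hk htau eps0 eta0; have [N HN] := surj_sum_small hk htau eps0 eta0.
exists (maxn N 1) => n; rewrite geq_max => /andP[Nn n0].
apply: le_trans (HN n Nn); set W := size_window _ _.
pose P s := (0 < s)%N && (eps <= `|s%:R / n%:R - nu k tau|).
pose G s : R := if P s then (surj (s * k) s)%:R / n%:R ^+ (s * k) else 0.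
apply: (@le_trans _ _ (\sum_(S : {set 'I_n}) G #|S|)); last first.
  rewrite sum_by_card big_ltn// {1}/G /P ltnn/= mulr0 add0r [leRHS]big_mkcond/=.
  apply: ler_sum_nat => s /andP[s0 _].
  by rewrite /G /P s0/=; case: ifP; rewrite ?mulr0.
pose img (D : kout n k) S : {set 'I_n} := [set x in map D (enum (out_arcs k S))].
apply: (@le_trans _ _ (\sum_(S : {set 'I_n} | P #|S|) Ex (fun D => (img D S == S)%:R))).
  rewrite -Ex_sum; apply: le_Ex => D.
  have [//|noW] := boolP (has_closed_scc W D); first by rewrite sumr_ge0.
  have [S SD] := exists_closed_scc D n0.
  have PS : P #|S|.
    have /closed_sccsP[v Sv _] := SD.
    apply/andP; split; first by rewrite Sv (cardD1 v) scc_id.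
    rewrite leNgt; apply: contra noW => WS.
    by apply/fintype.existsP; exists S; rewrite SD.
  rewrite (bigD1 S)//= /img closed_scc_onto//; last exact: ltnW.
  by rewrite eqxx lerDl sumr_ge0.
rewrite big_mkcond; apply: ler_sum => S _; rewrite /G; case: ifP => // _.
have := @Ex_onto R n k S (enum (out_arcs k S)) (enum_uniq _).
by rewrite -cardE card_out_arcs.
Qed.

(** * Cycles inside a fixed set of vertices *)

Section Cycles.
Variables (n k : nat).
Local Notation arc := ('I_n * 'I_k)%type.
Implicit Types (D : kout n k) (U : {set 'I_n}) (A B : {set arc}) (p q : seq arc).

Definition starts p : seq 'I_n := [seq a.1 | a <- p].

Definition follows D : rel arc := fun a b => D a == b.1.

Lemma path_follows D a p b :
  path (follows D) a (rcons p b) = (map D (a :: p) == rcons (starts p) b.1).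
Proof.
elim: p a => [|c p IHp] a /=; first by rewrite andbT eqseq_cons andbT.
by rewrite IHp [in RHS]eqseq_cons.
Qed.

Lemma cycle_follows D p : cycle (follows D) p = (map D p == rot 1 (starts p)).
Proof. by case: p => // a p; rewrite /= path_follows rot1_cons. Qed.

(** A cycle with a marked first arc. That each arc ends where the next one starts is written as an
    equality of sequences, the form of event treated by [Ex_map]. *)
Definition rooted_cycle U D p :=
  [&& uniq (starts p), map D p == rot 1 (starts p) & all (mem U) (starts p)].

Lemma uniq_starts p : uniq (starts p) -> uniq p.
Proof. exact: map_uniq. Qed.

Lemma starts_inj p : uniq (starts p) -> {in p &, injective fst}.
Proof.
elim: p => //= c p IHp /andP[cp up] a b; rewrite !inE.
case/predU1P => [->|ap] /predU1P[->//|bp] ab; last exact: IHp.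
  by move: cp; rewrite ab map_f.
by move: cp; rewrite -ab map_f.
Qed.

Lemma rooted_cycle_set U D a q : rooted_cycle U D (a :: q) ->
  [set x in a :: q] \in induced_cycles D U.
Proof.
set p := a :: q => /and3P[up cp pU].
have DU b : b \in p -> b.1 \in U by move=> bp; apply: (allP pU); exact: map_f.
have DU' b : b \in p -> D b \in U.
  move=> bp; have : D b \in map D p by exact: map_f.
  by rewrite (eqP cp) mem_rot => /mapP[c cq ->]; exact: DU.
have cA : size p = #|[set x in p]|.
  by rewrite cardsE (card_uniqP (uniq_starts up)).
rewrite inE; apply/andP; split.
  by apply/fintype.subsetP => b; rewrite !inE => /[dup]/DU -> /DU' ->.
apply/andP; split; first by apply/set0Pn; exists a; rewrite inE mem_head.
pose t := tcast cA (in_tuple p).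
have tE : tval t = p by rewrite val_tcast.
apply/fintype.existsP; exists t; apply/and3P; split; rewrite ?tE//.
- by move: cp; rewrite -cycle_follows.
- by apply/eqP/finset.setP => x; rewrite !inE memtE tE.
Qed.

Lemma rooted_cycle_exists U D A a : A \in induced_cycles D U -> a \in A ->
  exists2 q, rooted_cycle U D (a :: q) & A = [set x in a :: q].
Proof.
rewrite inE => /andP[AU /andP[_ /fintype.existsP[t /and3P[ct ut /eqP At]]]] aA.
have [p [cp up AE]] : exists p,
    [/\ cycle (follows D) p, uniq (starts p) & A = [set b in p]].
  by exists t; split => //; rewrite [LHS]At; apply/finset.setP => b; rewrite !inE memtE.
have ap : a \in p by move: aA; rewrite AE inE.
case: (rot_to ap) => i q iq; exists q; last first.
  by rewrite AE; apply/finset.setP => x; rewrite !inE -[in RHS]in_cons -iq mem_rot.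
have cq : cycle (follows D) (a :: q) by rewrite -iq rot_cycle.
apply/and3P; split; last 1 first.
- apply/allP => v /mapP[b]; rewrite -iq mem_rot => bp ->.
  have : b \in A by rewrite AE inE.
  by move/(fintype.subsetP AU); rewrite inE => /andP[].
- by rewrite /starts -iq map_rot rot_uniq.
- by rewrite -cycle_follows.
Qed.

(** Starting vertices are distinct, so [A] and [D] determine the successor of each arc: the cycle is
    the orbit of its root, and root and arc set determine the sequence. *)
Lemma rooted_cycle_traject U D a q A : rooted_cycle U D (a :: q) ->
  A = [set x in a :: q] ->
  q = traject (fun x => odflt a [pick b in A | b.1 == D x])
        (odflt a [pick b in A | b.1 == D a]) #|A|.-1.
Proof.
move=> /and3P[up cp _] AE; set f := fun x => odflt a _.
have cA : #|A| = (size q).+1.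
  by rewrite AE cardsE (card_uniqP (uniq_starts up)).
have fE x y : y \in a :: q -> follows D x y -> f x = y.
  move=> yq /eqP xy; rewrite /f; case: pickP => [b /andP[bA /eqP bx]|/(_ y)] /=.
    apply: (starts_inj up) => //; first by move: bA; rewrite AE inE.
    by rewrite bx xy.
  by rewrite AE inE yq xy eqxx.
have : fpath f a q.
  move: cp; rewrite -cycle_follows /= rcons_path => /andP[pq _].
  apply: (sub_in_path (P := mem (a :: q))) pq; last exact/allP.
  by move=> x y _ yq /(fE _ _ yq) /eqP.
by move=> /fpathE qE; rewrite cA.
Qed.

Lemma rooted_cycle_inj U D a p q : rooted_cycle U D (a :: p) ->
  rooted_cycle U D (a :: q) -> [set x in a :: p] = [set x in a :: q] -> p = q.
Proof.
move=> cp cq pq.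
by rewrite (rooted_cycle_traject cp erefl) [RHS](rooted_cycle_traject cq pq).
Qed.

Lemma card_rooted_cycle U D p : rooted_cycle U D p -> #|[set x in p]| = size p.
Proof. by case/and3P => up _ _; rewrite cardsE (card_uniqP (uniq_starts up)). Qed.

Definition cycles_in (L : pred nat) U D : {set {set arc}} :=
  [set A in induced_cycles D U | L #|A|].

Lemma in_cycles_in (L : pred nat) U D A :
  (A \in cycles_in L U D) = (A \in induced_cycles D U) && L #|A|.
Proof. by rewrite finset.in_set. Qed.

Lemma induced_cycles_sub U D D' A : {in A, D =1 D'} ->
  A \in induced_cycles D U -> A \in induced_cycles D' U.
Proof.
move=> DD' AD; have /set0Pn[a aA] : A != finset.set0.
  by move: AD; rewrite inE => /andP[_ /andP[]].
have [q cq Aq] := rooted_cycle_exists AD aA.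
rewrite Aq; apply: rooted_cycle_set; move: cq; rewrite /rooted_cycle.
suff -> : map D (a :: q) = map D' (a :: q) by [].
by apply/eq_in_map => b bq; apply: DD'; rewrite Aq inE.
Qed.

Lemma eq_in_cycles_in (L : pred nat) U D D' A : {in A, D =1 D'} ->
  (A \in cycles_in L U D) = (A \in cycles_in L U D').
Proof.
move=> DD'; rewrite !in_cycles_in; congr (_ && _).
apply/idP/idP; first exact: induced_cycles_sub.
by apply: induced_cycles_sub => a /DD'.
Qed.

(** For a given arc set [A], sending a rooted cycle to its root is a bijection onto [A]. *)
Lemma card_rooted_cycles U D l :
  #|[set p : l.+1.-tuple arc | rooted_cycle U D p]| =
  (l.+1 * #|cycles_in (pred1 l.+1) U D|)%N.
Proof.
set Q := [set p : l.+1.-tuple arc | _]; pose h (p : l.+1.-tuple arc) := [set x in p].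
have hE (p : l.+1.-tuple arc) : h p = [set x in thead p :: behead p].
  by apply/finset.setP => x; rewrite !inE {1}[p]tuple_eta inE.
have QE (p : l.+1.-tuple arc) : rooted_cycle U D p -> rooted_cycle U D (thead p :: behead p).
  by rewrite {1}[p]tuple_eta.
rewrite -sum1_card (partition_big h (mem (cycles_in (pred1 l.+1) U D)))/=; last first.
  move=> p; rewrite inE => pQ; rewrite inE hE (rooted_cycle_set (QE p pQ))/=.
  by rewrite (card_rooted_cycle (QE p pQ)) /= size_behead size_tuple.
rewrite mulnC -sum_nat_const; apply: eq_bigr => A; rewrite inE => /andP[AD /eqP cA].
rewrite sum1dep_card -[in RHS]cA.
have hinj : {in [set p in Q | h p == A] &, injective (fun p : l.+1.-tuple arc => thead p)}.
  move=> p q; rewrite !inE => /andP[pQ /eqP pA] /andP[qQ /eqP qA] pq.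
  have pQ' := QE p pQ; have qQ' := QE q qQ.
  apply: val_inj; rewrite [p]tuple_eta [q]tuple_eta/= -pq; congr cons.
  apply: (@rooted_cycle_inj U D (thead p)); [exact: pQ'| rewrite [thead p]pq; exact: qQ'|].
  by rewrite -hE [in RHS]pq -hE pA qA.
transitivity #|[set thead p | p in [set p in Q | h p == A]]|.
  by rewrite card_in_imset//; apply: eq_card => p; rewrite !inE.
congr #|pred_of_set _|; apply/finset.setP => a; apply/imsetP/idP.
  move=> [p]; rewrite !inE => /andP[_ /eqP <-] ->.
  by rewrite inE mem_tnth.
move=> aA; have [q cq Aq] := rooted_cycle_exists AD aA.
have sz : size (a :: q) == l.+1 by rewrite -(card_rooted_cycle cq) -Aq cA.
exists (Tuple sz) => //; rewrite !inE /= cq/=; apply/eqP.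
by rewrite Aq; apply/finset.setP => x; rewrite !inE.
Qed.

Lemma card_uniq_starts U l :
  #|[set p : l.-tuple arc | uniq (starts p) && all (mem U) (starts p)]| =
  (#|U| ^_ l * k ^ l)%N.
Proof.
pose h (t : l.-tuple 'I_n * l.-tuple 'I_k) : l.-tuple arc := [tuple of zip t.1 t.2].
have hfst t : [seq a.1 | a <- h t] = t.1 by rewrite [LHS]unzip1_zip// !size_tuple.
have hsnd t : [seq a.2 | a <- h t] = t.2 by rewrite [LHS]unzip2_zip// !size_tuple.
have hinj : injective h.
  move=> [t u] [t' u'] E; congr (_, _); apply: val_inj => /=.
    by rewrite -[LHS](hfst (t, u)) E hfst.
  by rewrite -[LHS](hsnd (t, u)) E hsnd.
have <- : #|finset.setX [set t : l.-tuple 'I_n | all (mem U) t & uniq t]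
      [set: l.-tuple 'I_k]| = (#|U| ^_ l * k ^ l)%N.
  by rewrite cardsX card_uniq_tuples cardsT card_tuple card_ord.
rewrite -(card_imset _ hinj); apply: eq_card => p; rewrite inE.
apply/idP/imsetP => [/andP[up pU]|[t + ->]]; last first.
  by rewrite !inE andbT /starts hfst andbC.
exists (map_tuple fst p, map_tuple snd p); first by rewrite !inE andbT andbC; apply/andP.
by apply: val_inj; rewrite /= zip_map -[LHS]map_id; apply: eq_map => -[].
Qed.

End Cycles.

(** * Expected number of cycles *)

Section ExpectedCycles.
Variables (R : realType) (n k : nat).
Local Notation arc := ('I_n * 'I_k)%type.
Implicit Types (D : kout n k) (U : {set 'I_n}) (A B : {set arc}) (p q : seq arc).

Definition cycle_rate (L : pred nat) U : R :=
  \sum_(1 <= l < n.+1 | L l) (#|U| ^_ l)%:R / n%:R ^+ l * (k%:R ^+ l / l%:R).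

(** Rooted cycles are counted by linearity, each candidate sequence having probability n^(-(l+1));
    each cycle is counted l+1 times. *)
Lemma Ex_cycles_of_length U l :
  Ex (fun D => #|cycles_in (pred1 l.+1) U D|%:R) =
  (#|U| ^_ l.+1)%:R / n%:R ^+ l.+1 * (k%:R ^+ l.+1 / l.+1%:R) :> R.
Proof.
have l0 : l.+1%:R != 0 :> R by rewrite pnatr_eq0.
apply: (mulfI l0); rewrite -ExZ.
rewrite (eq_Ex (g := fun D => \sum_(p : l.+1.-tuple arc |
   uniq (starts p) && all (mem U) (starts p)) (map D p == rot 1 (starts p))%:R)); last first.
  move=> D; rewrite -natrM -card_rooted_cycles -sum1dep_card natr_sum.
  rewrite big_mkcond [RHS]big_mkcond; apply: eq_bigr => p _; rewrite /rooted_cycle.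
  by case: uniq => //=; case: all; case: (_ == _).
rewrite Ex_sum (eq_bigr (fun=> n%:R ^- l.+1)); last first.
  move=> p /andP[up _].
  have sz : size p = size (rot 1 (starts p)) by rewrite size_rot size_map.
  by rewrite Ex_map ?size_tuple//; exact: uniq_starts.
rewrite sumr_const -[LHS]mulr_natl.
rewrite [X in X%:R * _](_ : _ = (#|U| ^_ l.+1 * k ^ l.+1)%N); last first.
  by rewrite -card_uniq_starts; apply: eq_card => p; rewrite inE.
rewrite natrM natrX.
by move: l0 (n%:R ^- _) (_ ^_ _)%:R (_ ^+ _) => ? ? ? ?; field.
Qed.

Lemma cycle_size U D A : A \in induced_cycles D U -> (0 < #|A| <= n)%N.
Proof.
move=> AD; have /set0Pn[a aA] : A != finset.set0.
  by move: AD; rewrite inE => /andP[_ /andP[]].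
have [q cq ->] := rooted_cycle_exists AD aA.
rewrite (card_rooted_cycle cq)/=; case/and3P: cq => up _ _.
have := max_card (mem (starts (a :: q))).
by rewrite (card_uniqP up) size_map card_ord.
Qed.

Lemma card_cycles_in (L : pred nat) U D :
  #|cycles_in L U D| = (\sum_(1 <= l < n.+1 | L l) #|cycles_in (pred1 l) U D|)%N.
Proof.
have E (L' : pred nat) : #|cycles_in L' U D| =
    (\sum_(A in induced_cycles D U) L' #|A|)%N.
  by rewrite -sum1dep_card big_mkcondr; apply: eq_bigr => A _; case: (L' _).
rewrite E; under [RHS]eq_bigr do rewrite E.
rewrite exchange_big; apply: eq_bigr => A /cycle_size cA /=.
rewrite big_mkcond (bigD1_seq #|A|) ?iota_uniq ?mem_index_iota//= eqxx.
rewrite big1 ?addn0; first by case: (L _).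
by move=> l /negbTE; rewrite eq_sym => ->; case: ifP.
Qed.

Lemma Ex_cycles_in (L : pred nat) U :
  Ex (fun D => #|cycles_in L U D|%:R) = cycle_rate L U.
Proof.
rewrite (eq_Ex (g := fun D =>
    \sum_(1 <= l < n.+1 | L l) #|cycles_in (pred1 l) U D|%:R)); last first.
  by move=> D; rewrite card_cycles_in natr_sum.
rewrite Ex_sum /cycle_rate big_nat_cond [RHS]big_nat_cond.
by apply: eq_bigr => -[//|l] _; rewrite Ex_cycles_of_length.
Qed.

End ExpectedCycles.

Lemma card_bigcup_le (I T : finType) (F : I -> {set T}) :
  (#|(\bigcup_i F i)%SET| <= \sum_i #|F i|)%N.
Proof.
elim/big_rec2: _ => [|i m B _ h]; first by rewrite cards0.
by rewrite (leq_trans (leq_card_setU _ _))// leq_add2l.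
Qed.

(** * Cycles that share an arc *)

Section Ears.
Variables (n k : nat).
Local Notation arc := ('I_n * 'I_k)%type.
Implicit Types (D : kout n k) (U : {set 'I_n}) (A B : {set arc}) (p q : seq arc).

(** Induction along a cycle: a property that passes from each arc to the next one spreads from one
    arc to all. *)
Lemma cycle_orbit D U A a (E : {pred arc}) : A \in induced_cycles D U ->
  a \in A -> a \in E ->
  (forall x y, x \in E -> x \in A -> y \in A -> D x = y.1 -> y \in E) ->
  {subset A <= E}.
Proof.
move=> AD aA aE HE; have [q /and3P[_ cq _] AE] := rooted_cycle_exists AD aA.
move: cq; rewrite -cycle_follows /= rcons_path => /andP[pq _].
have qA : {subset q <= A} by move=> x xq; rewrite AE inE in_cons xq orbT.
suff qE : {subset q <= E}.
  by move=> x; rewrite AE inE in_cons => /predU1P[->//|]; exact: qE.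
elim: q a aA aE {AE} pq qA => //= y q IHq a aA aE /andP[/eqP ay yq] qA.
have yA : y \in A by apply: qA; rewrite in_cons eqxx.
have yE : y \in E by apply: HE ay.
move=> x; rewrite in_cons => /predU1P[->//|]; apply: IHq yq _ x => // z zq.
by apply: qA; rewrite in_cons zq orbT.
Qed.

Lemma cycle_next D U A a : A \in induced_cycles D U -> a \in A ->
  exists2 b, b \in A & b.1 = D a.
Proof.
move=> AD aA; have [q /and3P[_ /eqP cq _] ->] := rooted_cycle_exists AD aA.
have : D a \in map D (a :: q) by rewrite map_f ?mem_head.
by rewrite cq mem_rot => /mapP[b bq ->]; exists b; rewrite ?inE.
Qed.

Lemma cycle_starts_inj D U A : A \in induced_cycles D U -> {in A &, injective fst}.
Proof.
move=> AD a b aA; have [q /and3P[uq _ _] AE] := rooted_cycle_exists AD aA.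
by move: aA; rewrite AE !inE; exact: (starts_inj uq).
Qed.

(** [B] must leave [A] at some vertex of [A]. Otherwise following [B] from the common arc gives that
    [B] is contained in [A]; then following [A], whose starting vertices are distinct, gives the
    converse inclusion. *)
Lemma ear_start D U A B a :
  A \in induced_cycles D U -> B \in induced_cycles D U -> a \in A -> a \in B ->
  A != B -> exists b c, [/\ b \in B, b \notin A, c \in A & b.1 = c.1].
Proof.
move=> AD BD aA aB AB.
suff /fintype.existsP[b /fintype.existsP[c /and4P[? ? ? /eqP ?]]] :
    [exists b : arc, [exists c : arc, [&& b \in B, b \notin A, c \in A & b.1 == c.1]]].
  by exists b, c.
apply: contraT; rewrite negb_exists => /fintype.forallP H.
have {}H b c : b \in B -> c \in A -> b.1 = c.1 -> b \in A.
  move=> bB cA bc; have := H b; rewrite negb_exists => /fintype.forallP/(_ c).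
  by rewrite bB cA bc eqxx !andbT negbK.
have BA : {subset B <= A}.
  apply: (cycle_orbit BD aB aA) => x y xA _ yB xy.
  by have [c cA cx] := cycle_next AD xA; apply: (H y c); rewrite // cx.
have AB' : {subset A <= B}.
  apply: (cycle_orbit AD aA aB) => x y xB _ yA xy.
  have [c cB cx] := cycle_next BD xB.
  by rewrite (cycle_starts_inj AD yA (BA _ cB)) // cx.
by rewrite -(negbTE AB); apply/eqP/finset.setP => x; apply/idP/idP => [/AB'|/BA].
Qed.

Lemma first_return D (V : {pred 'I_n}) b q :
  path (follows D) b q -> D (last b q) \in V ->
  exists p w, [/\ prefix p q, map D (b :: p) = rcons (starts p) w, w \in V
    & all (fun x => x.1 \notin V) p].
Proof.
elim: q b => [|y q IHq] b /=; first by exists [::], (D b).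
move=> /andP[/eqP byE yq] qV; have [DV|DV] := boolP (D b \in V).
  by exists [::], (D b).
have [p [w [pq Dp wV pV]]] := IHq y yq qV.
exists (y :: p), w; split=> //; first by rewrite /= eqxx.
- by rewrite [LHS]/= byE; move: Dp => /= ->.
- by rewrite /= -byE DV.
Qed.

(** A cycle together with an ear, that is, a path leaving and rejoining it: the arcs of the cycle,
    the position where the ear leaves, the label of its first arc, its further arcs, and the
    position where it ends. There are l+t+2 arcs, but only l+t+1 free vertices. *)
Definition ear l t := (l.+1.-tuple arc * 'I_l.+1 * 'I_k * t.-tuple arc * 'I_l.+1)%type.

Definition ear_cycle l t (e : ear l t) : seq arc := e.1.1.1.1.

Definition ear_arcs l t (e : ear l t) : seq arc :=
  let: (q, i, lab, p, j) := e in q ++ ((tnth q i).1, lab) :: p.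

Definition ear_ends l t (e : ear l t) : seq 'I_n :=
  let: (q, i, lab, p, j) := e in rot 1 (starts q) ++ rcons (starts p) (tnth q j).1.

Definition is_ear D l t (e : ear l t) :=
  uniq (ear_arcs e) && (map D (ear_arcs e) == ear_ends e).

Lemma size_ear_arcs l t (e : ear l t) : size (ear_arcs e) = (l + t).+2.
Proof.
by case: e => [[[[q i] lab] p] j]; rewrite size_cat/= !size_tuple addSn addnS.
Qed.

Lemma card_ear l t : #|{: ear l t}| =
  ((n * k) ^ l.+1 * l.+1 * k * (n * k) ^ t * l.+1)%N.
Proof. by rewrite !card_prod !card_tuple !card_ord card_prod !card_ord. Qed.

(** Follow [B] from the arc given by [ear_start] until it first meets a vertex of [A] again. *)
Lemma ear_exists (L : pred nat) m D U A B a : (forall l, L l -> (l <= m)%N) ->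
  A \in cycles_in L U D -> B \in cycles_in L U D -> a \in A -> a \in B ->
  A != B -> exists (l : 'I_m) (t : 'I_m) (e : ear l t),
  is_ear D e /\ A = [set x in ear_cycle e].
Proof.
move=> Lm; rewrite [A \in _]inE [B \in _]inE => /andP[AD /Lm Am] /andP[BD /Lm Bm] aA aB AB.
have [b [c [bB bA cA bc]]] := ear_start AD BD aA aB AB.
have [q cq Aq] := rooted_cycle_exists AD cA.
have [r cr Br] := rooted_cycle_exists BD bB.
move: Am Bm; rewrite {1}Aq {1}Br (card_rooted_cycle cq) (card_rooted_cycle cr)/= => qm rm.
case/and3P: cq => uq /eqP Dq _; case/and3P: cr => ur + _.
rewrite -cycle_follows /= rcons_path => /andP[pr /eqP lr].
pose V := [pred v | v \in starts (c :: q)].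
have startsA x : (x.1 \in V) -> exists2 y, y \in c :: q & x.1 = y.1.
  by move=> /mapP[y yq ->]; exists y.
have cV : b.1 \in V by rewrite bc; exact: map_f (mem_head c q).
have [p [w [pr' Dp wV pV]]] := first_return (V := V) pr (etrans (congr1 (mem V) lr) cV).
have [t0 pt] : exists t0 : 'I_m, size p = t0.
  have sp : (size p < m)%N by rewrite (leq_trans _ rm)// ltnS size_prefix.
  by exists (Ordinal sp).
have [l0 ql] : exists l0 : 'I_m, size (c :: q) = l0.+1 by exists (Ordinal qm).
move: wV => /mapP[d dq wd].
have jP : (index d (c :: q) < l0.+1)%N by rewrite -ql index_mem.
have /eqP ql' := ql; have /eqP pt' := pt.
(* The ear leaves at position 0, since [A] was rooted at the arc [c] that has the same start as
   [b]. *)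
exists l0, t0, (Tuple ql', ord0, b.2, Tuple pt', Ordinal jP); split=> //; rewrite /is_ear.
have -> : ear_arcs (Tuple ql', ord0, b.2, Tuple pt', Ordinal jP) = (c :: q) ++ b :: p.
  by rewrite /ear_arcs; congr (_ ++ _ :: _); rewrite (tnth_nth c)/= -bc -surjective_pairing.
apply/andP; split; last first.
  rewrite map_cat Dq Dp /ear_ends; apply/eqP; congr (_ ++ rcons _ _).
  by rewrite (tnth_nth c)/= nth_index.
(* [b] is not in [A] and the arcs of [p] start off [A], so ear and cycle share no arc; the ear
   itself is a piece of [B]. *)
rewrite cat_uniq (uniq_starts uq) andTb cons_uniq; apply/and3P; split.
- apply/hasPn => x; rewrite in_cons => /predU1P[->|xp].
    by move: bA; rewrite Aq inE.
  by apply: contra (allP pV _ xp) => xq; exact: map_f.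
- move: (uniq_starts ur) => /= /andP[+ _]; apply: contra.
  by have /prefixP[s ->] := pr'; rewrite mem_cat => ->.
- by move: (uniq_starts ur) => /= /andP[_]; exact: prefix_uniq.
Qed.

End Ears.

(** * Approximate Poisson recursion *)

Section Recursion.
Variables (R : realType) (n k : nat).
Hypothesis n0 : (0 < n)%N.
Local Notation arc := ('I_n * 'I_k)%type.
Implicit Types (D : kout n k) (U : {set 'I_n}) (A B : {set arc}) (p q : seq arc).
Variables (L : pred nat) (m : nat) (U : {set 'I_n}).
Hypothesis Lm : forall l, L l -> (l <= m)%N.

Let cyc D := cycles_in L U D.

Let nR : 0 < n%:R :> R. Proof. by rewrite ltr0n. Qed.
Let nne0 : n%:R != 0 :> R. Proof. by rewrite gt_eqF. Qed.

Definition arc_const : R := \sum_(l < m) k%:R ^+ l.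

(** The number of ears of each shape is n^(l+t+1) times the summand, by [card_ear]. *)
Definition ear_const : R :=
  \sum_(l < m) \sum_(t < m) k%:R ^+ (l + t).+2 * l.+1%:R ^+ 2.

Lemma arc_const_ge0 : 0 <= arc_const.
Proof. by apply: sumr_ge0. Qed.

(** Root the cycle at [a]: the l other arcs can be chosen in at most (nk)^l ways, against a
    probability n^(-(l+1)). *)
Lemma Ex_cycles_through (a : arc) :
  Ex (fun D => #|[set A in cyc D | a \in A]|%:R) <= arc_const / n%:R.
Proof.
pose Q D (l : 'I_m) := [set p : l.-tuple arc |
  uniq (a :: p) && (map D (a :: p) == rot 1 (starts (a :: p)))].
pose h (l : 'I_m) (p : l.-tuple arc) := [set x in a :: p].
apply: (@le_trans _ _ (Ex (fun D => \sum_(l < m) \sum_(p : l.-tuple arc | uniq (a :: p))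
    (map D (a :: p) == rot 1 (starts (a :: p)))%:R))).
  apply: le_Ex => D.
  apply: (@le_trans _ _ (\sum_(l < m) #|Q D l|)%:R); last first.
    rewrite natr_sum; apply: ler_sum => l _.
    rewrite -sum1dep_card natr_sum big_mkcondr.
    by apply: ler_sum => p _; case: (_ == _).
  rewrite ler_nat; apply: (@leq_trans #|(\bigcup_l (h l @: Q D l))%SET|).
    apply/subset_leq_card/fintype.subsetP => A.
    rewrite finset.in_set in_cycles_in => /andP[/andP[AD /Lm Am] aA].
    have [q cq Aq] := rooted_cycle_exists AD aA.
    have qm : (size q < m)%N by move: Am; rewrite Aq (card_rooted_cycle cq).
    apply/finset.bigcupP; exists (Ordinal qm) => //; apply/imsetP.
    exists (in_tuple q : (Ordinal qm).-tuple arc) => //.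
    by rewrite inE; case/and3P: cq => uq cq _; rewrite (uniq_starts uq).
  apply: leq_trans (card_bigcup_le _) _; apply: leq_sum => l _.
  exact: leq_imset_card.
rewrite Ex_sum /arc_const mulr_suml; apply: ler_sum => l _; rewrite Ex_sum.
apply: (@le_trans _ _ (\sum_(p : l.-tuple arc) n%:R ^- l.+1)).
  rewrite [leLHS]big_mkcond; apply: ler_sum => p _; case: ifP => [up|_].
    have := @le_Ex_map R n k (a :: p) (rot 1 (starts (a :: p))) up.
    by rewrite /= size_tuple.
  by rewrite invr_ge0 exprn_ge0.
rewrite sumr_const card_tuple card_prod !card_ord -[leLHS]mulr_natl.
rewrite natrX natrM exprMn exprSr invfM le_eqVlt; apply/orP; left; apply/eqP.
by field; rewrite nne0 expf_neq0.
Qed.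

Lemma Ex_card_le : Ex (fun D => #|cyc D|%:R) <= k%:R * arc_const.
Proof.
apply: (@le_trans _ _ (Ex (fun D => \sum_(a : arc) #|[set A in cyc D | a \in A]|%:R))).
  apply: le_Ex => D; rewrite -natr_sum ler_nat.
  apply: leq_trans (card_bigcup_le _); apply/subset_leq_card/fintype.subsetP => A AD.
  have /set0Pn[a aA] : A != finset.set0.
    by move: AD; rewrite in_cycles_in => /andP[/cycle_size/andP[+ _] _]; rewrite card_gt0.
  by apply/finset.bigcupP; exists a => //; rewrite inE AD.
rewrite Ex_sum; apply: (@le_trans _ _ (\sum_(a : arc) arc_const / n%:R)).
  by apply: ler_sum => a _; exact: Ex_cycles_through.
rewrite sumr_const card_prod !card_ord -[leLHS]mulr_natl natrM le_eqVlt.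
by apply/orP; left; apply/eqP; field.
Qed.

Let meets D A := [exists B in cyc D, (A != B) && ~~ [disjoint A & B]].

(** A cycle that shares an arc with another one carries an ear, and an ear has one arc more than
    free vertices, hence the factor 1/n. *)
Lemma Ex_meeting_cycles :
  Ex (fun D => #|[set A in cyc D | meets D A]|%:R) <= ear_const / n%:R.
Proof.
pose Q D (lt : 'I_m * 'I_m) := [set e : ear n k lt.1 lt.2 | is_ear D e].
pose h (lt : 'I_m * 'I_m) (e : ear n k lt.1 lt.2) := [set x in ear_cycle e].
apply: (@le_trans _ _ (Ex (fun D => \sum_(lt : 'I_m * 'I_m)
    \sum_(e : ear n k lt.1 lt.2 | uniq (ear_arcs e))
      (map D (ear_arcs e) == ear_ends e)%:R))).
  apply: le_Ex => D.
  apply: (@le_trans _ _ (\sum_lt #|Q D lt|)%:R); last first.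
    rewrite natr_sum; apply: ler_sum => lt _.
    rewrite -sum1dep_card natr_sum big_mkcondr.
    by apply: ler_sum => p _; case: (_ == _).
  rewrite ler_nat; apply: (@leq_trans #|(\bigcup_lt (h lt @: Q D lt))%SET|).
    apply/subset_leq_card/fintype.subsetP => A.
    rewrite finset.in_set => /andP[AD /fintype.existsP[B /and3P[BD AB]]].
    move=> /pred0Pn[a /andP[aA aB]].
    have [l [t [e [eD ->]]]] := ear_exists Lm AD BD aA aB AB.
    apply/finset.bigcupP; exists (l, t) => //; apply/imsetP.
    by exists e; rewrite ?inE.
  apply: leq_trans (card_bigcup_le _) _; apply: leq_sum => l _.
  exact: leq_imset_card.
rewrite Ex_sum /ear_const pair_big/= mulr_suml; apply: ler_sum => -[l t] _ /=.
rewrite Ex_sum.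
apply: (@le_trans _ _ (\sum_(e : ear n k l t) n%:R ^- (l + t).+2)).
  rewrite [leLHS]big_mkcond; apply: ler_sum => e _; case: ifP => [ue|_].
    by have := @le_Ex_map R n k _ (ear_ends e) ue; rewrite size_ear_arcs.
  by rewrite invr_ge0 exprn_ge0.
rewrite sumr_const card_ear -[leLHS]mulr_natl.
rewrite !natrM !natrX !natrM le_eqVlt; apply/orP; left; apply/eqP.
have -> : n%:R ^- (l + t).+2 = n%:R ^- l.+1 * n%:R ^- t * n%:R^-1 :> R.
  by rewrite -!invfM -exprD -exprSr addSn.
have -> : k%:R ^+ (l + t).+2 = k%:R ^+ l.+1 * k%:R ^+ t * k%:R :> R.
  by rewrite -exprD -exprSr addSn.
rewrite !exprMn; have : n%:R ^+ l.+1 != 0 :> R by rewrite expf_neq0.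
have : n%:R ^+ t != 0 :> R by rewrite expf_neq0.
move: (n%:R ^+ l.+1) (n%:R ^+ t) (k%:R ^+ l.+1) (k%:R ^+ t) => a b c d b0 a0.
by field; rewrite nne0 a0 b0.
Qed.

Definition recursion_const : R := ear_const + k%:R * arc_const * (m%:R * arc_const).

(** With X the number of cycles, (j+1) P(X = j+1) is the sum over [A] of P(A is a cycle, X = j+1).
    Let [W] count the cycles disjoint from [A]; it is independent of the arcs of [A]. If [A] is a
    cycle that meets no other, then X = W + 1. The two terms of [recursion_const] are the costs of
    cycles that meet another one and of replacing W by X. *)
Lemma poisson_recursion (j : nat) :
  `|j.+1%:R * Ex (fun D => (#|cyc D| == j.+1)%:R) -
    Ex (fun D => #|cyc D|%:R) * Ex (fun D => (#|cyc D| == j)%:R)|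
  <= recursion_const / n%:R.
Proof.
pose W A D := #|[set B in cyc D | [disjoint B & A]]|.
pose I A D : R := (A \in cyc D)%:R.
have Icyc (f : {set arc} -> R) D : \sum_A I A D * f A = \sum_(A in cyc D) f A.
  by rewrite [RHS]big_mkcond; apply: eq_bigr => A _; rewrite /I; case: ifP => _;
    rewrite ?mul1r ?mul0r.
have cardE D : #|cyc D|%:R = \sum_A I A D.
  by rewrite -sum1_card natr_sum -Icyc; apply: eq_bigr => A _; rewrite mulr1.
have depI A : depends_on A (I A).
  by move=> D D' /eq_in_cycles_in E; rewrite /I /cyc E.
have depW A j' : depends_on (~: A) (fun D => (W A D == j')%:R : R).
  move=> D D' DD'; congr ((_ == _)%:R); apply: eq_card => B.
  rewrite [LHS]finset.in_set [RHS]finset.in_set.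
  apply: andb_id2r => /disjointFr BA. apply: eq_in_cycles_in => a aB.
  by apply: DD'; rewrite inE BA.
have -> : j.+1%:R * Ex (fun D => (#|cyc D| == j.+1)%:R) =
    \sum_A Ex (fun D => I A D * (#|cyc D| == j.+1)%:R).
  rewrite -ExZ -Ex_sum; apply: eq_Ex => D; rewrite -mulr_suml -cardE.
  by case: eqP => [->|_]; rewrite ?mulr0.
have -> : Ex (fun D => #|cyc D|%:R) * Ex (fun D => (#|cyc D| == j)%:R) =
    \sum_A Ex (I A) * Ex (fun D => (#|cyc D| == j)%:R).
  by rewrite -mulr_suml -Ex_sum; congr (_ * _); apply: eq_Ex => D; exact: cardE.
rewrite -sumrB.
apply: (@le_trans _ _ (\sum_A (Ex (fun D => I A D * (meets D A)%:R) +
   Ex (I A) * (m%:R * arc_const / n%:R)))).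
  apply: (le_trans (ler_norm_sum _ _ _)); apply: ler_sum => A _.
  have IA0 : 0 <= Ex (I A) by rewrite Ex_ge0// => D; rewrite /I.
  set x := Ex _; set y := _ * _.
  (* The intermediate term P(A is a cycle) P(W = j) factors by independence. *)
  rewrite -(subrKA (Ex (I A) * Ex (fun D => (W A D == j)%:R))).
  apply: (le_trans (ler_normD _ _)); apply: lerD.
    rewrite -(Ex_indep (depI A) (depW A j)) -ExB.
    apply: (le_trans (le_norm_Ex _)); apply: le_Ex => D.
    rewrite -mulrBr /I; case: (boolP (A \in cyc D)) => AD; last first.
      by rewrite !mul0r normr0.
    rewrite !mul1r; have [_|mA] := boolP (meets D A).
      by case: (_ == _); case: (_ == _);
        rewrite ?subrr ?subr0 ?sub0r ?normrN ?normr1 ?normr0.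
    have -> : cyc D = A |: [set B in cyc D | [disjoint B & A]].
      apply/finset.setP => B; rewrite in_setU1 [in RHS]finset.in_set.
      have [->|BA] := eqVneq B A; first by rewrite AD.
      apply/idP/andP => [BD|[]//]; split=> //; rewrite disjoint_sym.
      apply: contraNT mA => AB; apply/fintype.existsP; exists B.
      by rewrite BD eq_sym BA.
    rewrite cardsU1 finset.in_set; suff -> : [disjoint A & A] = false.
      by rewrite andbF /= add1n eqSS subrr normr0.
    apply/negbTE/pred0Pn; move: AD; rewrite in_cycles_in => /andP[/cycle_size/andP[+ _] _].
    by rewrite card_gt0 => /set0Pn[a aA]; exists a; rewrite /= aA.
  rewrite /y -mulrBr normrM ger0_norm//.
  have [Am|Am] := leqP #|A| m; last first.
    suff -> : Ex (I A) = 0 by rewrite !mul0r.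
    rewrite -[RHS](@Ex_cst R n k); apply: eq_Ex => D; rewrite /I in_cycles_in.
    by case: (boolP (L #|A|)) => [/Lm|]; rewrite ?andbF// leqNgt Am.
  rewrite ler_wpM2l// -ExB (le_trans (le_norm_Ex _))//.
  (* W and X differ only if some cycle passes through one of the at most [m] arcs of [A]. *)
  apply: (@le_trans _ _ (Ex (fun D => \sum_(a in A) #|[set B in cyc D | a \in B]|%:R))).
    apply: le_Ex => D; have [->|WX] := eqVneq (W A D) #|cyc D|.
      by rewrite subrr normr0 sumr_ge0.
    have [B BD BA] : exists2 B, B \in cyc D & ~~ [disjoint B & A].
      apply/exists_inP; apply: contraNT WX; rewrite negb_exists => /fintype.forallP H.
      apply/eqP/eq_card => B; rewrite finset.in_set; apply: andb_idr => BD.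
      by have := H B; rewrite BD negbK.
    have /pred0Pn[a /andP[aB aA]] := BA.
    rewrite (bigD1 a)//= (@le_trans _ _ 1)//.
      by case: (_ == _); case: (_ == _);
        rewrite ?subrr ?subr0 ?sub0r ?normrN ?normr1 ?normr0.
    rewrite -[leLHS]addr0 lerD ?sumr_ge0// ler1n card_gt0; apply/set0Pn; exists B.
    by rewrite finset.in_set BD.
  rewrite Ex_sum; apply: (@le_trans _ _ (\sum_(a in A) arc_const / n%:R)).
    by apply: ler_sum => a _; exact: Ex_cycles_through.
  rewrite sumr_const -[leLHS]mulr_natl mulrA ler_wpM2r ?invr_ge0//.
  by rewrite ler_wpM2r ?arc_const_ge0// ler_nat.
rewrite big_split/= -[X in _ + X <= _]mulr_suml -!Ex_sum /recursion_const mulrDl; apply: lerD.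
  apply: le_trans Ex_meeting_cycles; apply: le_Ex => D.
  rewrite Icyc -sum1dep_card natr_sum big_mkcondr/= le_eqVlt; apply/orP; left; apply/eqP.
  by apply: eq_bigr => A _; case: (meets D A).
rewrite [leLHS]mulrA ler_wpM2r ?invr_ge0// ler_wpM2r ?mulr_ge0 ?arc_const_ge0//.
by rewrite (eq_Ex (g := fun D => #|cyc D|%:R)) ?Ex_card_le.
Qed.

End Recursion.

(** * Poisson limit *)

(** A product of factors (M - i)/n, each close to u; as all quantities stay in [0, 1], the errors
    add up. *)
Lemma ffact_ratio (R : realType) (n M l : nat) (u eps : R) : (0 < n)%N -> (M <= n)%N ->
  0 <= u <= 1 -> 0 <= eps -> `|M%:R / n%:R - u| <= eps ->
  `|(M ^_ l)%:R / n%:R ^+ l - u ^+ l| <= l%:R * (eps + l%:R / n%:R).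
Proof.
move=> n0 Mn /andP[u0 u1] eps0 Mu; have nR : 0 < n%:R :> R by rewrite ltr0n.
elim: l => [|l IHl].
  by rewrite ffactn0 !expr0 divr1 subrr normr0 mul0r.
have y0 : 0 <= (M ^_ l)%:R / n%:R ^+ l :> R by rewrite divr_ge0 ?exprn_ge0.
have y1 : (M ^_ l)%:R / n%:R ^+ l <= 1 :> R.
  rewrite ler_pdivrMr ?exprn_gt0// mul1r -natrX ler_nat.
  elim: l {IHl y0} => // l IHl.
  by rewrite ffactnSr expnSr leq_mul// (leq_trans (leq_subr _ _)).
have hx : `|(M - l)%:R / n%:R - u| <= eps + l%:R / n%:R.
  rewrite -(subrKA (M%:R / n%:R)) addrC (le_trans (ler_normD _ _))// lerD//.
  rewrite -mulrBl normrM [`|_^-1|]ger0_norm ?invr_ge0 ?(ltW nR)//.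
  rewrite ler_wpM2r ?invr_ge0 ?(ltW nR)//.
  (* For l > M the subtraction is truncated to 0, and the error is M/n <= l/n. *)
  have [lM|lM] := leqP l M.
    by rewrite natrB// addrAC subrr sub0r normrN ger0_norm.
  by rewrite (eqP (ltnW lM : _ - _ == 0)%N) sub0r normrN ger0_norm// ler_nat ltnW.
rewrite ffactnSr natrM !exprSr invfM mulrACA.
move: ((M ^_ l)%:R / n%:R ^+ l) y0 y1 IHl ((M - l)%:R / n%:R) hx => y y0 y1 IHl x hx.
have -> : y * x - u ^+ l * u = y * (x - u) + u * (y - u ^+ l) by ring.
apply: (le_trans (ler_normD _ _)); rewrite !normrM (ger0_norm y0) (ger0_norm u0).
have h1 : y * `|x - u| <= eps + l%:R / n%:R.
  by apply: le_trans hx; rewrite ler_piMl.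
have h2 : u * `|y - u ^+ l| <= l%:R * (eps + l%:R / n%:R).
  by apply: le_trans IHl; rewrite ler_piMl.
apply: (le_trans (lerD h1 h2)).
have -> : eps + l%:R / n%:R + l%:R * (eps + l%:R / n%:R) = l.+1%:R * (eps + l%:R / n%:R).
  by rewrite -natr1; ring.
by rewrite ler_wpM2l// lerD2l ler_wpM2r ?invr_ge0 ?(ltW nR)// ler_nat.
Qed.

Lemma is_derive_log_sum (R : realType) (m : nat) (x : R) :
  is_derive x 1 (fun y => \sum_(1 <= l < m.+1) y ^+ l / l%:R) (\sum_(l < m) x ^+ l).
Proof.
elim: m => [|m IHm].
  rewrite big_ord0 [X in is_derive _ _ X _](_ : _ = cst 0); first exact: is_derive_cst.
  by apply/funext => y; rewrite big_geq.
rewrite big_ord_recr/= [X in is_derive _ _ X _](_ : _ =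
  fun y => \sum_(1 <= l < m.+1) y ^+ l / l%:R + m.+1%:R^-1 * y ^+ m.+1); last first.
  by apply/funext => y; rewrite big_nat_recr//= [X in _ + X]mulrC.
apply: (is_derive_eq (is_derive1D IHm
  (is_derive1Z m.+1%:R^-1 (is_derive_pow m.+1 (is_derive_id x 1))))).
by rewrite mulr1 mulKf// pnatr_eq0.
Qed.

(** The remainder [f] vanishes at 0 and has derivative y^m / (1 - y), which lies between 0 and r^m /
    (1 - r) on [0, r]. *)
Lemma log_series (R : realType) (r : R) (m : nat) : 0 <= r < 1 ->
  `|ln (1 / (1 - r)) - \sum_(1 <= l < m.+1) r ^+ l / l%:R| <= r ^+ m / (1 - r).
Proof.
move=> /andP[r0 r1]; have d0 : 0 < 1 - r by rewrite subr_gt0.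
have -> : ln (1 / (1 - r)) = - ln (1 - r) by rewrite div1r lnV.
pose f (y : R) := - 1 * ln (1 - y) - \sum_(1 <= l < m.+1) y ^+ l / l%:R.
have df y : 0 <= y <= r -> is_derive y 1 f (y ^+ m / (1 - y)).
  move=> /andP[y0 yr]; have y1 : y < 1 := le_lt_trans yr r1.
  apply: (is_derive_eq (is_derive1B (is_derive1Z (-1) (is_derive_ln1B y1))
    (is_derive_log_sum m y))).
  have y1' : 1 - y != 0 by rewrite subr_eq0 gt_eqF.
  apply: (mulIf y1'); rewrite divfK// mulrBl mulN1r opprK mulVf// mulr_suml.
  under eq_bigr do rewrite mulrBr mulr1 -exprSr -opprB.
  rewrite sumrN -(big_mkord xpredT (fun i => y ^+ i.+1 - y ^+ i)) telescope_sumr//.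
  by rewrite expr0; ring.
have f0 : f 0 = 0.
  rewrite /f subr0 ln1 mulr0 sub0r big_nat big1 ?oppr0// => l /andP[l0 _].
  by rewrite expr0n gtn_eqF// mul0r.
have fr0 : 0 <= f r.
  rewrite -f0; apply: (ge0_derive_le r0 df) => y /andP[y0 yr].
  by rewrite divr_ge0 ?exprn_ge0// subr_ge0 (le_trans yr (ltW r1)).
have frE : f r = - ln (1 - r) - \sum_(1 <= l < m.+1) r ^+ l / l%:R by rewrite /f mulN1r.
rewrite -frE ger0_norm//.
pose c := r ^+ m / (1 - r).
pose g (y : R) := c * y - f y.
have dg y : 0 <= y <= r -> is_derive y 1 g (c * 1 - y ^+ m / (1 - y)).
  move=> y0r; have := is_derive1B (is_derive1Z c (is_derive_id y 1)) (df y y0r).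
  by [].
have : g 0 <= g r.
  apply: (ge0_derive_le r0 dg) => y /andP[y0 yr].
  rewrite mulr1 subr_ge0 /c.
  apply: ler_pM; rewrite ?exprn_ge0 ?invr_ge0 ?subr_ge0 ?(le_trans yr (ltW r1))//.
    by rewrite lerXn2r.
  by rewrite lef_pV2 ?posrE ?subr_gt0 ?(le_lt_trans yr)// lerD2l lerN2.
rewrite /g f0 mulr0 subr0 subr_ge0 => h; apply: (le_trans h).
by rewrite ler_piMr ?(ltW r1)// divr_ge0 ?exprn_ge0// ltW.
Qed.

Definition poisson_sum (R : realType) (rate : R) (N : nat) : R :=
  \sum_(j < N) rate ^+ j / j`!%:R * expR (- rate).

Definition num_le (R : realType) (x : R) : nat :=
  if 0 <= x then (Num.truncn x).+1 else 0.

Lemma natr_le_num (R : realType) (x : R) (m : nat) : (m%:R <= x) = (m < num_le x)%N.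
Proof.
rewrite /num_le; case: ifPn => x0; first by rewrite ltnS truncn_ge_nat.
by apply/negbTE; apply: contra x0; apply: le_trans.
Qed.

Lemma poisson_cdfE (R : realType) (rate x : R) : 0 < rate ->
  poisson_cdf rate x = poisson_sum rate (num_le x).
Proof.
move=> r0; rewrite /poisson_cdf /poisson_prob r0.
have -> : [set m : nat | m%:R <= x]%classic = `I_(num_le x).
  by apply/seteqP; split => m /=; rewrite natr_le_num.
rewrite esum_fset//; last by move=> i _; rewrite lee_fin poisson_pmf_ge0.
rewrite -fsbig_ord sumEFin/=; apply: eq_bigr => i _.
by rewrite /poisson_pmf r0.
Qed.

Lemma cvg_sum_ord (R : realType) (u : nat -> nat -> R) (l : nat -> R) (N : nat) :
  (forall j, u n j @[n --> \oo] --> l j)%classic ->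
  (\sum_(j < N) u n j @[n --> \oo] --> \sum_(j < N) l j)%classic.
Proof.
move=> ul; elim: N => [|N IHN].
  rewrite big_ord0 (_ : (fun n => _) = fun=> 0); first exact: cvg_cst.
  by apply/funext => n; rewrite big_ord0.
rewrite big_ord_recr (_ : (fun n => _) = fun n => \sum_(j < N) u n j + u n N).
  by apply: cvgD; [exact: IHN|exact: ul].
by apply/funext => n; rewrite big_ord_recr.
Qed.

Section PoissonLimit.
Local Open Scope classical_set_scope.
Variables (R : realType) (rate K : R) (q : nat -> nat -> R).
Hypotheses (rate0 : 0 <= rate) (q0 : forall n j, 0 <= q n j)
  (qrec : forall j, j.+1%:R * q n j.+1 - rate * q n j @[n --> \oo] --> (0 : R))
  (q1 : forall n J, \sum_(j < J) q n j <= 1)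
  (qtight : forall J (d : R), 0 < d ->
     \forall n \near \oo, 1 - (K / J.+1%:R + d) <= \sum_(j < J.+1) q n j).

Let c j := rate ^+ j / j`!%:R.

(** The approximate recursion fixes all the [q n j] up to the common factor [q n 0]. *)
Let cvg_ratio j : q n j - c j * q n 0 @[n --> \oo] --> (0 : R).
Proof.
elim: j => [|j IHj].
  rewrite (_ : (fun n => _) = fun=> 0); first exact: cvg_cst.
  by apply/funext => n; rewrite /c expr0 fact0 divr1 mul1r subrr.
have j0 : j.+1%:R != 0 :> R by rewrite pnatr_eq0.
have f0 : j`!%:R != 0 :> R by rewrite pnatr_eq0 -lt0n fact_gt0.
rewrite (_ : (fun n => _) = fun n => j.+1%:R^-1 * (j.+1%:R * q n j.+1 - rate * q n j)
    + rate / j.+1%:R * (q n j - c j * q n 0)); last first.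
  apply/funext => n; rewrite /c factS natrM exprS.
  by move: (j.+1%:R) (j`!%:R) j0 f0 => a b a0 b0; field; apply/andP.
have -> : (0 : R) = j.+1%:R^-1 * 0 + rate / j.+1%:R * 0 by rewrite !mulr0 addr0.
by apply: cvgD; apply: cvgMl_tmp; [exact: qrec|exact: IHj].
Qed.

Let exp_sum : \sum_(j < J.+1) c j @[J --> \oo] --> expR rate.
Proof.
have : series (exp_coeff rate) J @[J --> \oo] --> expR rate.
  exact: is_cvg_series_exp_coeff.
rewrite -cvg_shiftS.
suff -> : [sequence series (exp_coeff rate) J.+1]_J =
  fun J => \sum_(j < J.+1) c j by [].
by apply/funext => J; rewrite /series/= big_mkord.
Qed.

(** Normalization: by tightness a bounded range of j carries almost all the mass, and there the sum
    of the [q n j] is close to [q n 0] times e^rate. *)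
Let cvg_q0 : q n 0 @[n --> \oo] --> expR (- rate).
Proof.
have fin (a d S y z : R) : a <= d -> 1 - (a + d) <= S -> S <= 1 ->
    - d <= S - y -> S - y <= d -> - d <= z - y -> z - y <= d ->
    - (4 * d) <= 1 - z <= 4 * d.
  by move=> *; apply/andP; split; lra.
apply/cvgrPdist_le => /= e e0; have e4 : 0 < e / 4 by rewrite divr_gt0.
(* J makes both the escaping mass and the remainder of the exponential series small before n is
   chosen. *)
have [J [KJ EJ]] : exists J : nat, K / J.+1%:R <= e / 4 /\
    `|expR rate - \sum_(j < J.+1) c j| <= e / 4.
  have /cvgrPdist_le/(_ _ e4)[J1 _ HJ] := exp_sum.
  exists (maxn J1 (Num.truncn (K / (e / 4)))); split; last first.
    by apply: HJ; rewrite /= leq_maxl.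
  rewrite ler_pdivrMr ?ltr0n// mulrC -ler_pdivrMr//.
  by rewrite (le_trans (ltW (truncnS_gt _)))// ler_nat ltnS leq_maxr.
have hsum : \sum_(j < J.+1) (q n j - c j * q n 0) @[n --> \oo] --> (0 : R).
  have := @cvg_sum_ord _ (fun n j => q n j - c j * q n 0) (fun=> 0) J.+1 cvg_ratio.
  by rewrite big1.
near=> n.
have h1 : 1 - (K / J.+1%:R + e / 4) <= \sum_(j < J.+1) q n j.
  by near: n; exact: qtight.
have h2 : `|0 - \sum_(j < J.+1) (q n j - c j * q n 0)| <= e / 4.
  by near: n; move/cvgrPdist_le: hsum; apply.
have h3 : `|q n 0 * (expR rate - \sum_(j < J.+1) c j)| <= e / 4.
  rewrite normrM ger0_norm// (le_trans _ EJ)// ler_piMl//.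
  by have := q1 n 1; rewrite big_ord1.
have h4 := q1 n J.+1.
have -> : expR (- rate) - q n 0 = expR (- rate) * (1 - q n 0 * expR rate).
  by rewrite mulrBr mulr1 mulrCA expRN mulVf ?mulr1// gt_eqF ?expR_gt0.
rewrite normrM ger0_norm ?expR_ge0//.
have ex1 : expR (- rate) <= 1 by rewrite expR_le1 oppr_le0.
apply: (@le_trans _ _ `|1 - q n 0 * expR rate|); first by rewrite ler_piMl.
move: h2 h3; rewrite sumrB -mulr_suml mulrBr sub0r normrN.
move: (\sum_(j < J.+1) c j) (\sum_(j < J.+1) q n j) h1 h4 => E S h1 h4.
rewrite [E * _]mulrC !ler_norml => /andP[h2 h2'] /andP[h3 h3'].
have -> : e = 4 * (e / 4) by rewrite mulrC divfK// pnatr_eq0.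
exact: (fin _ _ _ _ _ KJ h1 h4 h2 h2').
Unshelve. all: by end_near. Qed.

Lemma poisson_limit j : q n j @[n --> \oo] --> rate ^+ j / j`!%:R * expR (- rate).
Proof.
rewrite (_ : (fun n => _) = fun n => (q n j - c j * q n 0) + c j * q n 0); last first.
  by apply/funext => n; rewrite subrK.
rewrite -[X in _ --> X]add0r; apply: cvgD; first exact: cvg_ratio.
by apply: cvgMl_tmp; exact: cvg_q0.
Qed.

Lemma poisson_sum_limit N :
  \sum_(j < N) q n j @[n --> \oo] --> poisson_sum rate N.
Proof. exact: (@cvg_sum_ord _ q _ N poisson_limit). Qed.

End PoissonLimit.

(** * Cycles outside the giant *)

Section GiantCycles.
Variables (R : realType) (k : nat) (tau : R).
Hypotheses (hk : (2 <= k)%N) (htau : is_tau k tau).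

Local Notation nu := (nu k tau).
(** Equal to k e^(-tau), by [expRNtau]. *)
Let rho : R := k%:R * (1 - nu).

Let k0 : 0 < k%:R :> R. Proof. by rewrite ltr0n (leq_trans _ hk). Qed.
Let n0 : 0 < nu. Proof. exact: nu_gt0 hk htau. Qed.
Let n1 : nu < 1. Proof. exact: nu_lt1 htau. Qed.
Let rho0 : 0 < rho. Proof. by rewrite mulr_gt0// subr_gt0. Qed.
Let rho1 : rho < 1. Proof. exact: k1nu_lt1 hk htau. Qed.

Lemma size_window_half n (eps : R) (S : {set 'I_n}) : (0 < n)%N ->
  eps <= nu - 2^-1 -> size_window nu eps S -> (n < 2 * #|S|)%N.
Proof.
move=> n_gt0 he; rewrite /size_window ltr_norml => /andP[h _].
have nR : 0 < n%:R :> R by rewrite ltr0n.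
have : 2^-1 < #|S|%:R / n%:R :> R.
  by move: h he; move: (_ / n%:R) => x h he; lra.
by rewrite ltr_pdivlMr// ltr_pdivrMl// -natrM ltr_nat.
Qed.

Lemma size_window_compl n (eps : R) (S : {set 'I_n}) : (0 < n)%N ->
  size_window nu eps S -> `|#|~: S|%:R / n%:R - (1 - nu)| < eps.
Proof.
move=> n_gt0; rewrite /size_window.
have nR : n%:R != 0 :> R by rewrite pnatr_eq0 -lt0n.
have -> : #|~: S|%:R / n%:R - (1 - nu) = - (#|S|%:R / n%:R - nu).
  have : (#|S| + #|~: S|)%:R = n%:R :> R by rewrite cardsC card_ord.
  by rewrite natrD => <-; field; rewrite -natrD cardsC card_ord.
by rewrite normrN.
Qed.

Definition limit_rate (L : pred nat) (m : nat) : R :=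
  \sum_(1 <= l < m.+1 | L l) rho ^+ l / l%:R.

Lemma cycle_rate_close (L : pred nat) m n (U : {set 'I_n}) (eps : R) :
  (forall l, L l -> (l <= m)%N) -> (0 < n)%N -> (m <= n)%N -> 0 <= eps ->
  `|#|U|%:R / n%:R - (1 - nu)| <= eps ->
  `|cycle_rate R k L U - limit_rate L m| <=
  (\sum_(1 <= l < m.+1) k%:R ^+ l) * (eps + m%:R / n%:R).
Proof.
move=> Lm n_gt0 mn eps0 hU.
have -> : cycle_rate R k L U =
    \sum_(1 <= l < m.+1 | L l) (#|U| ^_ l)%:R / n%:R ^+ l * (k%:R ^+ l / l%:R).
  rewrite /cycle_rate (@big_cat_nat _ _ _ m.+1)//= [X in _ + X]big_nat_cond.
  rewrite [X in _ + X]big1 ?addr0//.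
  by move=> l /andP[/andP[ml _] /Lm]; rewrite leqNgt ml.
rewrite -sumrB (le_trans (ler_norm_sum _ _ _))// mulr_suml big_mkcond.
apply: ler_sum_nat => l /andP[l0 lm].
have nR : 0 < n%:R :> R by rewrite ltr0n.
have lR : 0 < l%:R :> R by rewrite ltr0n.
have mn0 : 0 <= m%:R / n%:R :> R by rewrite divr_ge0.
case: ifP => _; last by rewrite mulr_ge0 ?exprn_ge0 ?addr_ge0.
have -> : (#|U| ^_ l)%:R / n%:R ^+ l * (k%:R ^+ l / l%:R) - rho ^+ l / l%:R =
    (k%:R ^+ l / l%:R) * ((#|U| ^_ l)%:R / n%:R ^+ l - (1 - nu) ^+ l).
  by rewrite /rho exprMn; ring.
rewrite normrM ger0_norm ?divr_ge0 ?exprn_ge0// -mulrA ler_wpM2l ?exprn_ge0//.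
rewrite ler_pdivrMl//.
have Un : (#|U| <= n)%N by rewrite -[leqRHS]card_ord max_card.
have u01 : 0 <= 1 - nu <= 1 by rewrite subr_ge0 (ltW n1)/= gerBl (ltW n0).
apply: (le_trans (ffact_ratio l n_gt0 Un u01 eps0 hU)).
by rewrite ler_wpM2l// lerD2l ler_wpM2r ?invr_ge0 ?(ltW nR)// ler_nat -ltnS.
Qed.

(** Every arc of a cycle outside [S] starts outside [S]; this is the independence required by
    [giant_transfer]. *)
Lemma depends_on_cycles_in n (L : pred nat) (S : {set 'I_n}) :
  depends_on (~: out_arcs k S) (fun D : kout n k => cycles_in L (~: S) D).
Proof.
have sub (D D' : kout n k) : {in ~: out_arcs k S, D =1 D'} ->
    cycles_in L (~: S) D \subset cycles_in L (~: S) D'.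
  move=> DD'; apply/fintype.subsetP => A AD; rewrite -(@eq_in_cycles_in _ _ _ _ D)//.
  move=> a aA; apply: DD'; move: AD; rewrite in_cycles_in inE => /andP[/andP[AU _] _].
  by move/fintype.subsetP: AU => /(_ a aA); rewrite !inE => /andP[].
by move=> D D' DD'; apply/eqP; rewrite finset.eqEsubset !sub// => a /DD'.
Qed.

Let X (L : pred nat) n (D : kout n k) := #|cycles_in L (~: giant D) D|.

(** Joins [giant_transfer] and [giant_size], with a threshold N that is uniform in [f]. *)
Lemma giant_transfer_eventually (B e eps delta : R) : 0 < eps -> 0 <= B ->
  0 < e -> 0 <= delta ->
  exists N : nat, forall n, (N <= n)%N ->
  forall f : {set 'I_n} -> kout n k -> R,
  (forall S, depends_on (~: out_arcs k S) (f S)) ->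
  (forall S D, `|f S D| <= B) ->
  (forall S, `|#|~: S|%:R / n%:R - (1 - nu)| <= eps -> `|Ex (f S)| <= delta) ->
  `|Ex (fun D => f (giant D) D)| <= delta + e.
Proof.
move=> eps0 B0 e0 d0.
(* Narrow enough for every set in the window to contain more than half of the vertices. *)
pose eps' := Num.min eps (nu - 2^-1).
have half := nu_gt_half hk htau.
have eps'0 : 0 < eps' by rewrite lt_min eps0 subr_gt0.
have [|N HN] := giant_size (eta := e / (B + 1)) hk htau eps'0.
  by rewrite divr_gt0// ltr_wpDl.
exists (maxn N 1) => n; rewrite geq_max => /andP[Nn n_gt0] f fdep fB fd.
have HW (S : {set 'I_n}) : size_window nu eps' S -> (n < 2 * #|S|)%N.
  by move=> WS; apply: (size_window_half n_gt0 _ WS); rewrite ge_min lexx orbT.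
apply: (le_trans (giant_transfer HW fdep fB d0 _)).
  move=> S WS; apply: fd; apply/ltW/(lt_le_trans (size_window_compl n_gt0 WS)).
  by rewrite ge_min lexx.
rewrite lerD2l; apply: (le_trans (ler_wpM2l B0 (HN n Nn))).
by rewrite mulrCA ler_piMr ?(ltW e0)// ler_pdivrMr ?ltr_wpDl// mul1r lerDl.
Qed.

(** * Poisson limit for cycles of bounded length *)

Section BoundedLength.
Variables (L : pred nat) (m : nat).
Hypothesis Lm : forall l, L l -> (l <= m)%N.

Lemma limit_rate_ge0 : 0 <= limit_rate L m.
Proof. by apply: sumr_ge0 => l _; rewrite divr_ge0// exprn_ge0// ltW. Qed.

Let q n j : R := Ex (fun D : kout n k => (X L D == j)%:R).

Lemma giant_recursion j :
  (j.+1%:R * q n j.+1 - limit_rate L m * q n j @[n --> \oo] --> (0 : R))%classic.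
Proof.
apply/cvgrPdist_le => e e0; have l0 := limit_rate_ge0.
pose K : R := \sum_(1 <= l < m.+1) k%:R ^+ l.
have K0 : 0 <= K by apply: sumr_ge0 => l _; exact: exprn_ge0.
pose C : R := recursion_const R k m + K * m%:R.
have e4 : 0 < e / 4 by rewrite divr_gt0.
(* Error budget: e/4 for atypical giants, e/4 for the window width times K, and e/4 for the terms of
   order 1/n. *)
have eps0 : 0 < e / 4 / (K + 1) by rewrite divr_gt0// ltr_wpDl.
have B0 : 0 <= j.+1%:R + limit_rate L m by rewrite addr_ge0.
have [N HN] := giant_transfer_eventually eps0 B0 e4 (ltW (divr_gt0 e0 (ltr0n R 2))).
exists (maxn (maxn N m.+1) (Num.truncn (C / (e / 4))).+1) => // n /=.
rewrite !geq_max => /andP[/andP[Nn mn] Cn].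
have n_gt0 : (0 < n)%N by rewrite (leq_trans _ mn).
have nR : 0 < n%:R :> R by rewrite ltr0n.
have Cn' : C / n%:R <= e / 4.
  rewrite ler_pdivrMr// mulrC -ler_pdivrMr//.
  by rewrite (le_trans (ltW (truncnS_gt _)))// ler_nat.
rewrite sub0r normrN.
pose f (S : {set 'I_n}) (D : kout n k) : R := j.+1%:R * (#|cycles_in L (~: S) D| == j.+1)%:R
  - limit_rate L m * (#|cycles_in L (~: S) D| == j)%:R.
rewrite [X in `|X|](_ : _ = Ex (fun D => f (giant D) D)); last first.
  by rewrite /f ExB !ExZ.
apply: (@le_trans _ _ (e / 2 + e / 4)); last by lra.
apply: HN => // [S D D' DD'|S D|S hS].
- by rewrite /f (depends_on_cycles_in L DD').
- rewrite /f (le_trans (ler_normB _ _))// !normrM !ger0_norm// lerD//.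
    by rewrite ler_piMr//; case: (_ == _).
  by rewrite ler_piMr//; case: (_ == _).
rewrite /f ExB !ExZ.
have := poisson_recursion R k n_gt0 (~: S) Lm j; rewrite Ex_cycles_in => h1.
have h2 := cycle_rate_close Lm n_gt0 (ltnW mn) (ltW eps0) hS.
set x := _ * _ in h1 *; set y := Ex (fun D => (_ == j)%:R) in h1 *.
have y01 : 0 <= y <= 1.
  rewrite Ex_ge0//= -[leRHS](@Ex_cst R n k); apply: le_Ex => D.
  by case: (_ == _).
rewrite -(subrKA (cycle_rate R k L (~: S) * y)) (le_trans (ler_normD _ _))//.
have h3 : `|cycle_rate R k L (~: S) * y - limit_rate L m * y| <=
    K * (e / 4 / (K + 1) + m%:R / n%:R).
  by rewrite -mulrBl normrM (le_trans _ h2)// [`|y|]ger0_norm ?ler_piMr//; case/andP: y01.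
apply: (le_trans (lerD h1 h3)).
have h4 : K * (e / 4 / (K + 1)) <= e / 4.
  by rewrite mulrCA ler_piMr ?(ltW e4)// ler_pdivrMr ?ltr_wpDl// mul1r lerDl.
move: Cn'; rewrite /C mulrDl mulrDr mulrA => h5.
by lra.
Qed.

(** Markov's inequality for each fixed [S], using the mean bound [Ex_card_le], which is uniform in
    [S] and n. *)
Lemma giant_tight J (d : R) : 0 < d -> exists N : nat, forall n, (N <= n)%N ->
  1 - (k%:R * arc_const R k m / J.+1%:R + d) <= \sum_(j < J.+1) q n j.
Proof.
move=> d0; have a0 : 0 <= k%:R * arc_const R k m by rewrite mulr_ge0// arc_const_ge0.
have J0 : 0 < J.+1%:R :> R by rewrite ltr0n.
have [N HN] := giant_transfer_eventually (eps := 1) ltr01 ler01 d0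
  (divr_ge0 a0 (ltW J0)).
exists (maxn N 1) => n; rewrite geq_max => /andP[Nn n_gt0].
pose f (S : {set 'I_n}) (D : kout n k) : R := (J < #|cycles_in L (~: S) D|)%:R.
have E : \sum_(j < J.+1) q n j = 1 - Ex (fun D => f (giant D) D).
  rewrite -(@Ex_cst R n k 1) -ExB -Ex_sum; apply: eq_Ex => D; rewrite /f -/(X L D).
  have [XJ|XJ] := ltnP J (X L D).
    rewrite subrr big1// => j _; apply/eqP; rewrite pnatr_eq0 eqb0 gtn_eqF//.
    by rewrite (leq_trans _ XJ).
  rewrite subr0 (bigD1 (inord (X L D)))//= inordK ?ltnS// eqxx big1 ?addr0// => j jX.
  by case: eqP => // Xj; move: jX; rewrite Xj inord_val eqxx.
rewrite E lerD2l lerN2 (le_trans (ler_norm _))//.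
apply: HN => // [S D D' DD'|S D|S _].
- by rewrite /f (depends_on_cycles_in L DD').
- by rewrite /f; case: (_ < _)%N; rewrite ?normr1 ?normr0.
rewrite ger0_norm ?Ex_ge0// ler_pdivlMr// mulrC -ExZ.
apply: (le_trans _ (Ex_card_le R k n_gt0 (~: S) Lm)); apply: le_Ex => D.
by rewrite /f; case: ltnP => h; rewrite ?mulr0// mulr1 ler_nat.
Qed.

Lemma giant_poisson N : (Ex (fun D : kout n k => (X L D < N)%:R)
  @[n --> \oo] --> poisson_sum (limit_rate L m) N)%classic.
Proof.
rewrite [X in (X @ _ --> _)%classic](_ : _ = fun n => \sum_(j < N) q n j); last first.
  apply/funext => n; rewrite -Ex_sum; apply: eq_Ex => D.
  have [XN|XN] := ltnP (X L D) N.
    rewrite (bigD1 (Ordinal XN))//= eqxx big1 ?addr0// => j.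
    by rewrite -val_eqE/= eq_sym => /negbTE ->.
  by rewrite big1// => j _; rewrite gtn_eqF// (leq_trans _ XN).
apply: (poisson_sum_limit (K := k%:R * arc_const R k m)).
- exact: limit_rate_ge0.
- by move=> n j; exact: Ex_ge0.
- exact: giant_recursion.
- move=> n J; rewrite -Ex_sum -[leRHS](@Ex_cst R n k); apply: le_Ex => D.
  have [XN|XN] := ltnP (X L D) J.
    rewrite (bigD1 (Ordinal XN))//= eqxx big1 ?addr0// => j.
    by rewrite -val_eqE/= eq_sym => /negbTE ->.
  by rewrite big1// => j _; rewrite gtn_eqF// (leq_trans _ XN).
- by move=> J d d0; have [M HM] := giant_tight J d0; exists M.
Qed.

End BoundedLength.

(** * Long cycles and passage to all lengths *)

Lemma giant_long_cycles (d : R) : 0 < d ->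
  exists m0 N : nat, forall m n, (m0 <= m)%N -> (N <= n)%N ->
  Ex (fun D : kout n k => (0 < X (fun l => m < l)%N D)%N%:R) <= d.
Proof.
move=> d0; have d2 : 0 < d / 2 by rewrite divr_gt0.
(* r is halfway between rho and 1, and k (1 - nu + eps) = r; the mean number of cycles of length l
   in the complement of [S] is then at most r^l. *)
pose r := (1 + rho) / 2; pose eps := (1 - rho) / (2 * k%:R).
have r0 : 0 < r by rewrite divr_gt0// addr_gt0.
have r1 : r < 1 by rewrite /r ltr_pdivrMr// mul1r [ltRHS]mulr2n ltrD2l.
have eps0 : 0 < eps by rewrite divr_gt0 ?subr_gt0 ?mulr_gt0.
have [||m0 Hm0] := @geometric_small R r (d / 2 * (1 - r)).
- by rewrite (ltW r0).
- by rewrite mulr_gt0// subr_gt0.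
have [N HN] := giant_transfer_eventually eps0 ler01 d2 (ltW d2).
exists m0, (maxn N 1) => m n m0m; rewrite geq_max => /andP[Nn n_gt0].
have nR : 0 < n%:R :> R by rewrite ltr0n.
pose f (S : {set 'I_n}) (D : kout n k) : R :=
  (0 < #|cycles_in (fun l => m < l) (~: S) D|)%N%:R.
rewrite (_ : d = d / 2 + d / 2); last by field.
rewrite (le_trans (ler_norm _))//.
apply: (HN n Nn f) => [S D D' DD'|S D|S hS].
- by rewrite /f (depends_on_cycles_in _ DD').
- by rewrite /f; case: (_ < _)%N; rewrite ?normr1 ?normr0.
rewrite ger0_norm ?Ex_ge0//.
apply: (@le_trans _ _ (Ex (fun D : kout n k =>
  #|cycles_in (fun l => m < l)%N (~: S) D|%:R))).
  by apply: le_Ex => D; rewrite /f ler_nat; case: (#|_|).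
have hr : k%:R * (#|~: S|%:R / n%:R) <= r.
  have -> : r = k%:R * (1 - nu + eps).
    by rewrite /r /eps mulrDr -/rho; field; rewrite gt_eqF.
  by rewrite ler_wpM2l// -lerBlDl (le_trans (ler_norm _)).
rewrite Ex_cycles_in /cycle_rate.
apply: (@le_trans _ _ (\sum_(m.+1 <= l < n.+1) r ^+ l)); last first.
  apply: (le_trans (geometric_tail _ _ _)); first by rewrite (ltW r0).
  rewrite ler_pdivrMr ?subr_gt0//; apply: le_trans Hm0.
  by rewrite ler_wiXn2l ?(ltW r0) ?(ltW r1)// ltnW.
rewrite big_mkcond [leRHS](big_nat_widenl _ 1)//= [leRHS]big_mkcond/=.
apply: ler_sum_nat => l /andP[l0 _]; case: ifP => // ml.
have lR : 0 < l%:R :> R by rewrite ltr0n.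
apply: (@le_trans _ _ ((k%:R * (#|~: S|%:R / n%:R)) ^+ l)); last first.
  by rewrite lerXn2r ?nnegrE ?(ltW r0)// mulr_ge0// divr_ge0.
rewrite exprMn expr_div_n mulrC; apply: ler_pM; rewrite ?divr_ge0 ?exprn_ge0//.
  by rewrite ler_pdivrMr// ler_peMr ?exprn_ge0// ler1n.
rewrite ler_wpM2r ?invr_ge0 ?exprn_ge0// -natrX ler_nat.
elim: l {l0 ml lR} => [|l IHl]; first by rewrite ffactn0.
by rewrite ffactnSr expnSr leq_mul// leq_subr.
Qed.

Lemma longest_cycle_tight :
  bounded_in_probability R (fun n (D : kout n k) => longest_cycle D).
Proof.
move=> e e0; have [m [N HN]] := giant_long_cycles e0.
(* Tightness is required for all n: below N, a cycle has length at most n, hence at most N. *)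
exists (maxn m N)%:R => n; rewrite PrE.
have [Nn|nN] := leqP N n.
  apply: le_trans (HN _ n (leq_maxl m N) Nn); apply: le_Ex => D.
  rewrite ltr_nat; case: ltnP => // h.
  have [A AD mA] : exists2 A, A \in induced_cycles D (~: giant D) & (maxn m N < #|A|)%N.
    apply/exists_inP; apply: contraLR h; rewrite negb_exists => /fintype.forallP H.
    rewrite -leqNgt; apply/bigmax_leqP => A AD; have := H A.
    by rewrite AD -leqNgt.
  suff -> : (0 < X (fun l => maxn m N < l)%N D)%N by [].
  by rewrite card_gt0; apply/set0Pn; exists A; rewrite in_cycles_in AD.
rewrite (eq_Ex (g := fun=> 0)) ?Ex_cst ?ltW// => D.
rewrite ltr_nat ltnNge (_ : (_ <= _)%N)//.
apply/bigmax_leqP => A /cycle_size/andP[_ An].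
by rewrite (leq_trans An)// (leq_trans (ltnW nN))// leq_maxr.
Qed.

Lemma poisson_sum_continuous (a : nat -> R) (l : R) (N : nat) :
  (a n @[n --> \oo] --> l)%classic ->
  (poisson_sum (a n) N @[n --> \oo] --> poisson_sum l N)%classic.
Proof.
move=> al; have pow j : (a n ^+ j @[n --> \oo] --> l ^+ j)%classic.
  elim: j => [|j IHj]; first by rewrite expr0; exact: cvg_cst.
  rewrite exprS (_ : (fun n => _) = fun n => a n * a n ^+ j); first exact: cvgM.
  by apply/funext => n; rewrite exprS.
apply: (@cvg_sum_ord _ (fun n j => a n ^+ j / j`!%:R * expR (- a n))
  (fun j => l ^+ j / j`!%:R * expR (- l))) => j.
apply: cvgM; first by apply: cvgMr_tmp; exact: pow.
by apply: (cvg_comp _ _ (cvgN al)); exact: continuous_expR.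
Qed.

Lemma rv_cdfE n (Y : kout n k -> nat) (x : R) :
  rv_cdf Y x = Ex (fun D => (Y D < num_le x)%N%:R).
Proof. by rewrite /rv_cdf PrE; apply: eq_Ex => D; rewrite natr_le_num. Qed.

(** Three errors of e/3: truncating the logarithmic series at m, the Poisson limit for lengths up to
    m, and the probability of a cycle longer than m. The cutoff m is fixed before n grows. *)
Lemma num_cycles_cvg : cvg_in_distribution (fun n (D : kout n k) => num_cycles D)
  (poisson_cdf (ln (1 / (1 - rho)))).
Proof.
move=> x _; have lam0 : 0 < ln (1 / (1 - rho)).
  by rewrite ln_gt0// div1r invf_gt1 ?subr_gt0// gtrBl.
rewrite poisson_cdfE//; under eq_fun do rewrite rv_cdfE.
set J := num_le x; set lam := ln _.
have rates : (limit_rate (fun l => l <= m)%N m @[m --> \oo] --> lam)%classic.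
  apply/cvgrPdist_le => e e0.
  have [||m0 Hm0] := @geometric_small R rho (e * (1 - rho)).
  - by rewrite (ltW rho0).
  - by rewrite mulr_gt0// subr_gt0.
  exists m0 => // m /= m0m.
  have -> : limit_rate (fun l => l <= m)%N m = \sum_(1 <= l < m.+1) rho ^+ l / l%:R.
    rewrite /limit_rate big_nat_cond [RHS]big_nat_cond; apply: eq_bigl => l.
    by rewrite ltnS; case: (l <= m)%N; rewrite ?andbT ?andbF.
  apply: (le_trans (log_series _ _)); first by rewrite (ltW rho0).
  rewrite ler_pdivrMr ?subr_gt0//; apply: le_trans Hm0.
  by rewrite ler_wiXn2l ?(ltW rho0) ?(ltW rho1).
apply/cvgrPdist_le => e e0; have e3 : 0 < e / 3 by rewrite divr_gt0.
have [m0 [N1 HN1]] := giant_long_cycles e3.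
have /cvgrPdist_le/(_ _ e3)[m1 _ Hm1] := @poisson_sum_continuous _ _ J rates.
pose m := maxn m0 m1.
have Lm l : (l <= m)%N -> (l <= m)%N by [].
have /cvgrPdist_le/(_ _ e3)[N2 _ HN2] := @giant_poisson _ m Lm J.
exists (maxn N1 N2) => // n /=; rewrite geq_max => /andP[n1' n2'].
have h1 := Hm1 m (leq_maxr _ _); have h2 := HN2 n n2'.
have h3 := HN1 m n (leq_maxl _ _) n1'.
have h4 : `|Ex (fun D : kout n k => (X (fun l => l <= m)%N D < J)%N%:R) -
    Ex (fun D : kout n k => (num_cycles D < J)%N%:R)| <= e / 3 :> R.
  apply: le_trans h3; rewrite -ExB (le_trans (le_norm_Ex _))//; apply: le_Ex => D.
  have [long|] := ltnP 0 (X (fun l => m < l)%N D).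
    by case: (_ < _)%N; case: (_ < _)%N;
      rewrite ?subrr ?subr0 ?sub0r ?normrN ?normr1 ?normr0.
  rewrite leqn0 cards_eq0 => /eqP long.
  suff -> : X (fun l => l <= m)%N D = num_cycles D by rewrite subrr normr0.
  apply: eq_card => A; rewrite in_cycles_in; apply: andb_idr => AD.
  rewrite leqNgt; apply: contraTN isT => mA.
  by have := finset.in_set0 A; rewrite -long in_cycles_in AD mA.
move: h1 h2 h4; set a := poisson_sum lam J; set b := poisson_sum _ J.
set c := Ex _; set y := Ex _ => h1 h2 h4.
have -> : a - y = (a - b) + (b - c) + (c - y) by ring.
have -> : e = e / 3 + e / 3 + e / 3 by field.
by rewrite (le_trans (ler_normD _ _))// lerD// (le_trans (ler_normD _ _))// lerD.
Qed.

Lemma num_cycles_of_length_cvg l : (1 <= l)%N ->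
  cvg_in_distribution (fun n (D : kout n k) => num_cycles_of_length l D)
    (poisson_cdf (rho ^+ l / l%:R)).
Proof.
move=> l1 x _; have lR : 0 < l%:R :> R by rewrite ltr0n.
rewrite poisson_cdfE ?divr_gt0 ?exprn_gt0//; under eq_fun do rewrite rv_cdfE.
have Ll i : pred1 l i -> (i <= l)%N by move=> /eqP ->.
have -> : rho ^+ l / l%:R = limit_rate (pred1 l) l.
  rewrite /limit_rate big_mkcond big_nat_recr//= eqxx big_nat big1 ?add0r// => i.
  by case/andP => _ /ltn_eqF ->.
exact: (@giant_poisson _ l Ll (num_le x)).
Qed.

End GiantCycles.

Theorem theorem2 (R : realType) (k : nat) (hk : (2 <= k)%N)
    (tau : R) (htau : is_tau k tau) :
  [/\ bounded_in_probability R (fun n (D : kout n k) => longest_cycle D),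
      cvg_in_distribution (fun n (D : kout n k) => num_cycles D)
        (poisson_cdf (ln (1 / (1 - k%:R * expR (- tau)))))
    & forall l : nat, (1 <= l)%N ->
      cvg_in_distribution (fun n (D : kout n k) => num_cycles_of_length l D)
        (poisson_cdf ((k%:R * expR (- tau)) ^+ l / l%:R))].
Proof.
rewrite (expRNtau htau); split.
- exact: longest_cycle_tight hk htau.
- exact: num_cycles_cvg hk htau.
- exact: num_cycles_of_length_cvg hk htau.
Qed.
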